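(* Let $\mathcal F_m(M)$ be a one-parameter exponential family with mean parameters in $(0,M]$, whose log-partition function $b$ is twice differentiable with continuous second derivative $b''>0$ on $\Theta$, and whose variance function $V$ satisfies, for some $C_L>0$, $|V(\mu)-V(\mu')|\le C_L|\mu-\mu'|$ for all $\mu,\mu'\in(0,M]$. Then there is a constant $C>0$, depending only on the family (through $M$, $C_L$ and $V$), such that for every $K\ge2$, every $T\ge2$, and every $K$-armed bandit problem whose reward distributions all belong to the (known) family $\mathcal F_m(M)$, the algorithm General-Exp-KL-MS with $L(k)=k$ satisfies $$\mathrm{Reg}(T)\le C\sum_{a\in[K]:\Delta_a>0}\Big(\frac{\ln T}{\Delta_a}+\Delta_a\Big),\qquad \Delta_a=\mu_{\max}-\mu_a.$$
   Context: Exponential family: given a base measure $m$ on $\mathbb R$, $\{p_\theta(dx)=m(dx)\exp(x\theta-b(\theta)):\theta\in\Theta\}$, where $\Theta\subset\mathbb R$ is an interval and $b(\theta)=\ln\int_{\mathbb R}e^{x\theta}m(dx)$. Members are determined by their mean $b'(\theta)$. The variance function $V(\mu)$ is the variance of the member with mean $\mu$. $\mathrm{KL}(\mu,\mu')$ denotes the Kullback–Leibler divergence $\mathbb E_{X\sim\nu}[\ln\frac{d\nu}{d\nu'}(X)]$ between the members $\nu,\nu'$ with means $\mu,\mu'$. Bandit: each arm $a\in[K]=\{1,\dots,K\}$ has reward distribution $\nu_a$ in the family with mean $\mu_a$; $\mu_{\max}=\max_a\mu_a$. In round $t=1,\dots,T$ the agent picks $I_t\in[K]$ (based on the past and internal randomness)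 and receives $r_t\sim\nu_{I_t}$, independent of the past given $I_t$. $N_{t,a}=\sum_{i\le t}\mathbf 1\{I_i=a\}$, $\hat\mu_{t,a}=\frac1{N_{t,a}}\sum_{i\le t}r_i\mathbf 1\{I_i=a\}$, $\hat\mu_{t,\max}=\max_a\hat\mu_{t,a}$. It is assumed that empirical means are means of members of the exponential family. Regret: $\mathrm{Reg}(T)=\mathbb E\big[\sum_{t=1}^T(\mu_{\max}-\mu_{I_t})\big]$. General-Exp-KL-MS with inverse temperature function $L$: in rounds $t\le K$ pull $I_t=t$; in each round $t>K$ pull $I_t=a$ with probability $p_{t,a}=\exp\!\big(-L(N_{t-1,a})\,\mathrm{KL}(\hat\mu_{t-1,a},\hat\mu_{t-1,\max})\big)/M_t$, where $M_t$ normalizes the probabilities to sum to $1$. *)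

(* Defs.v *)
From HB Require Import structures.
From mathcomp Require Import all_boot all_order all_algebra.
From mathcomp Require Import all_classical all_reals all_analysis.

Set Implicit Arguments.
Unset Strict Implicit.
Unset Printing Implicit Defensive.

Import Order.TTheory GRing.Theory Num.Theory.
Import numFieldNormedType.Exports.

Local Open Scope classical_set_scope.
Local Open Scope ring_scope.

Section real_line_laws.
Context {R : realType}.
Local Notation law := (probability (measurableTypeR R) R).
Implicit Types nu : law.

Definition mean nu : R := fine 'E_nu[idfun].

Definition var nu : R := fine 'V_nu[idfun].

Local Open Scope charge_scope.

Definition KL nu nu' : \bar R :=
  if `[< nu `<< nu' >] then
    ('E_nu[fun x =>
       ln (fine (('d (charge_of_finite_measure nu) '/d nu') x))])%E
  else +oo%E.

End real_line_laws.

Section exponential_family.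
Context {R : realType}.
Local Notation law := (probability (measurableTypeR R) R).
Variables (m : {measure set (measurableTypeR R) -> \bar R}) (Theta : set R).

Definition laplace (theta : R) : \bar R :=
  (\int[m]_x (expR (x * theta))%:E)%E.

Definition log_partition (theta : R) : R := ln (fine (laplace theta)).

(* The bounds on the Laplace transform say that b is real-valued on Theta. *)
Definition is_exp_family : Prop :=
  is_interval Theta /\
  forall theta, Theta theta -> (0 < laplace theta < +oo)%E.

Definition exp_family : set law :=
  [set nu : law | exists2 theta, Theta theta &
    forall A, measurable A ->
      nu A = (\int[m]_(x in A)
                (expR (x * theta - log_partition theta))%:E)%E].

Definition exp_family_le (M : R) : set law :=
  [set nu | exp_family nu /\ 0 < mean nu <= M].

Definition mean_space : set R := mean @` exp_family.

(* The member of the family with mean mu; an unspecified law when mu is not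
   in the mean space. *)
Definition member_of_mean (mu : R) : law :=
  get [set nu : law | exp_family nu /\ mean nu = mu].

Definition KL_mean (mu mu' : R) : R :=
  fine (KL (member_of_mean mu) (member_of_mean mu')).

(* Only the values of V on the mean space are constrained. *)
Definition is_variance_function (V : R -> R) : Prop :=
  forall mu, mean_space mu -> V mu = var (member_of_mean mu).

(* Derivative relative to Theta: the ordinary derivative at an interior point,
   the one-sided derivative at an endpoint belonging to Theta. *)
Definition has_derivative_within (f : R -> R) (x l : R) : Prop :=
  (f y - f x) / (y - x) @[y --> within Theta x^'] --> l.

Definition smooth_log_partition : Prop :=
  exists b' b'' : R -> R,
    [/\ forall theta, Theta theta ->
          has_derivative_within log_partition theta (b' theta),
        forall theta, Theta theta ->
          has_derivative_within b' theta (b'' theta),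
        {within Theta, continuous b''} &
        forall theta, Theta theta -> 0 < b'' theta].

End exponential_family.

(* Arms are 'I_K, so arm a here is arm a.+1 of [K] = {1, ..., K}; rounds are
   numbered from 1 and the values at index 0 of I and r are never used. *)
Section bandit.
Context {R : realType} (K : nat).

(* For K > 0 the range is finite and nonempty, so this is the maximum. *)
Definition arm_max (x : 'I_K -> R) : R := sup (range x).

Section statistics.
Context {Omega : Type} (I : nat -> Omega -> 'I_K) (r : nat -> Omega -> R).

Definition pulls (t : nat) (a : 'I_K) (w : Omega) : nat :=
  (\sum_(1 <= i < t.+1) (I i w == a))%N.

Definition emp_mean (t : nat) (a : 'I_K) (w : Omega) : R :=
  (\sum_(1 <= i < t.+1 | I i w == a) r i w) / (pulls t a w)%:R.

Definition kl_weight (L : nat -> R) (kl : R -> R -> R)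
    (t : nat) (a : 'I_K) (w : Omega) : R :=
  expR (- L (pulls t.-1 a w) *
        kl (emp_mean t.-1 a w) (arm_max (fun b => emp_mean t.-1 b w))).

Definition exp_kl_ms (L : nat -> R) (kl : R -> R -> R)
    (t : nat) (a : 'I_K) (w : Omega) : R :=
  if (t <= K)%N then (a.+1 == t)%:R
  else kl_weight L kl t a w / \sum_(b < K) kl_weight L kl t b w.

(* The sigma-algebra generated by (I_i, r_i) for 1 <= i < t. *)
Definition past (t : nat) : set (set Omega) :=
  <<s [set E : set Omega | exists2 i, (1 <= i < t)%N &
        (exists a, E = [set w | I i w = a]) \/
        (exists2 B : set (measurableTypeR R), measurable B &
           E = r i @^-1` B)] >>.

End statistics.

Section run.
Context (nu : 'I_K -> probability (measurableTypeR R) R) (T : nat).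
Context {d : measure_display} {Omega : measurableType d}.
Variables (P : probability Omega R).
Variables (I : nat -> Omega -> 'I_K) (r : nat -> Omega -> R).

(* Given the past, I_t = a has conditional probability p t a (defining property
   of conditional expectation); given the past and I_t = a, r_t has law nu a. *)
Definition bandit_run (p : nat -> 'I_K -> Omega -> R) : Prop :=
  forall t, (1 <= t <= T)%N ->
  [/\ forall a, measurable [set w | I t w = a],
      measurable_fun setT (r t : Omega -> measurableTypeR R),
      forall a E, past I r t E ->
        P (E `&` [set w | I t w = a]) = (\int[P]_(w in E) (p t a w)%:E)%E &
      forall a E (B : set (measurableTypeR R)), past I r t E -> measurable B ->
        P (E `&` [set w | I t w = a] `&` r t @^-1` B) =
        (P (E `&` [set w | I t w = a]) * nu a B)%E].

Definition emp_means_in (S : set R) : Prop :=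
  {ae P, forall w, forall t a, (1 <= t <= T)%N -> (0 < pulls I t a w)%N ->
    S (emp_mean I r t a w)}.

Definition gap (a : 'I_K) : R := arm_max (mean \o nu) - mean (nu a).

Definition regret : \bar R :=
  ('E_P[fun w => (\sum_(1 <= t < T.+1) gap (I t w))%R])%E.

End run.
End bandit.

(* Main.v *)
(** Kullback-Leibler divergences between members are Bregman divergences of the
    log-partition function b, so they satisfy a Pythagorean inequality along the
    line, and b' = mean, b'' = V o b' together with the boundedness of V on
    (0, M] give KL(x, y) >= (x - y)^2 / (4 c) with c = |V M| + CL M.

    Fix a suboptimal arm a with gap g, let y' = mu_a + g / 3, y = mu_max - g / 3,
    so that KL(y', y), KL(y', mu_a) and KL(y, mu_max) are at least
    D = g^2 / (36 c).  A pull of a after its first (ln T) / D pulls falls in one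
    of three cases: both the mean of a and the maximal mean are estimated
    correctly, and the sampling probability of a is at most 1 / T; a is
    overestimated, and a Chernoff bound at its k-th pull gives a geometric
    series in exp(- k D); all arms are estimated below y.  In the last case the
    probability of pulling a is at most exp(k KL(hat, y)) times that of pulling
    the best arm, where k and hat are the pull count and the empirical mean of
    the best arm.  Peeling on the integer part j of k KL(hat, y), the factor
    exp(j + 1) is compensated by the Chernoff bound exp(- j - k D), and only
    j < 2 ln T + 1 matters because larger deviations have probability at most
    T^-2.  Altogether a is pulled O(1 + (ln T) / D) times on average. *)

Require Import Defs.
From HB Require Import structures.
From mathcomp Require Import all_boot all_order all_algebra.
From mathcomp Require Import all_classical all_reals all_analysis.
From mathcomp Require Import measurable_realfun ring lra zify.

Set Implicit Arguments.
Unset Strict Implicit.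
Unset Printing Implicit Defensive.

Import Order.TTheory GRing.Theory Num.Theory.
Import numFieldNormedType.Exports.

Local Open Scope classical_set_scope.
Local Open Scope ring_scope.

(** * Nonnegative integrals and densities *)

(** The variance is controlled only on (0, M], while an empirical mean may be any mean of a member,
    possibly above M. The quadratic lower bound is therefore applied only to the fixed points mu_a,
    y', y and mu_max, all in (0, M]; random means are compared with them through monotonicity of KL
    in each argument, a consequence of the Pythagorean inequality. Cutting the gap into thirds makes
    the three divergences meet the same bound (g / 3)^2 / (4 c) = D.

    Arms are chosen adaptively, so the rewards of one arm are not given as an i.i.d. sequence. The
    Chernoff bounds come from a product of likelihood ratios frozen after the k-th pull, whose
    expectation is 1 at every time. A bound at the k-th pull then covers the choice made at the next
    pull in whatever round it happens, with no union bound over time.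

    The threshold y is kept below mu_max so that Pythagoras through y adds k D to the exponent of
    every layer. This surplus makes the sum over k at most 1 / D per layer, so that O(ln T) layers
    cost O((ln T) / D). *)

Section lower_integral.
Context d (T : measurableType d) (R : realType).
Variable mu : {measure set T -> \bar R}.
Local Open Scope ereal_scope.

Import HBNNSimple.

(* Stated for arbitrary nonnegative functions because the sampling
   probabilities are not known to be measurable; the integral is then the
   supremum over the simple functions below. *)
Lemma ae_le_lower_integral (E : set T) (f g : T -> \bar R) (c : R) :
  (0 < c)%R -> measurable E ->
  (forall x, E x -> 0 <= f x) -> (forall x, E x -> 0 <= g x) ->
  {ae mu, forall x, E x -> f x <= c%:E * g x} ->
  \int[mu]_(x in E) f x <= c%:E * \int[mu]_(x in E) g x.
Proof.
move=> c0 mE f0 g0 [N [mN N0 subN]].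
rewrite ge0_integralE// ge0_integralE//; apply: ge_ereal_sup => _ [h /= hf <-].
have ci0 : (0 <= c^-1)%R by rewrite invr_ge0 ltW.
(* Dividing by c and vanishing on the null set turns a simple function below f into a simple
   function below g everywhere on E, hence a competitor in the supremum for g. *)
pose h' : {nnsfun T >-> R} := scale_nnsfun (proj_nnsfun h (measurableC mN)) ci0.
have h'E x : h' x = (c^-1 * (h x * \1_(~` N) x))%R.
  by [].
clearbody h'.
have step : sintegral mu h <= c%:E * sintegral mu h'.
  have -> : sintegral mu h = \int[mu]_x (h x)%:E by rewrite integral_nnsfun//= patch_setT.
  have -> : sintegral mu h' = \int[mu]_x (h' x)%:E by rewrite integral_nnsfun//= patch_setT.
  rewrite -ge0_integralZl_EFin//; last 3 first.
  - by move=> x _; rewrite lee_fin.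
  - exact/measurable_EFinP.
  - exact: ltW.
  rewrite (@ge0_ae_eq_integral _ _ _ mu setT (EFin \o h) (fun x => c%:E * (h' x)%:E))//.
  - exact/measurable_EFinP.
  - apply: measurable_funeM; exact/measurable_EFinP.
  - by move=> x _; rewrite lee_fin.
  - by move=> x _; rewrite -EFinM lee_fin mulr_ge0// ltW.
  exists N; split => // x /= /not_implyP[_] xh; apply: contrapT => xN.
  by apply: xh; rewrite h'E indicE mem_set// mulr1 -EFinM mulrA mulfV ?gt_eqF// mul1r.
apply: (le_trans step); rewrite lee_pmul2l ?lte_fin//.
apply: ereal_sup_ubound; exists h' => //= x; rewrite h'E.
have [xN|xN] := pselect (N x).
  rewrite indicE memNset; last by move=> /(_ xN).
  by rewrite !mulr0 erestrict_ge0.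
rewrite indicE mem_set// mulr1.
have := hf x; rewrite /patch; case: ifPn => xE.
  move=> hfx; have xE' : E x by rewrite inE in xE.
  have : f x <= c%:E * g x by apply: contrapT => xx; apply: xN; apply: subN => /= /(_ xE').
  move=> /(le_trans hfx) hg.
  by rewrite EFinM lee_pdivrMl.
by rewrite !lee_fin => h0; rewrite mulr_ge0_le0.
Qed.

(** The hypothesis is the case of indicators; simple functions follow by linearity and f by monotone
    convergence along [nnsfun_approx]. *)
Lemma ge0_integral_density (nu : {measure set T -> \bar R}) (h : T -> R)
    (f : T -> \bar R) :
  measurable_fun setT h -> (forall x, (0 <= h x)%R) ->
  (forall A, measurable A -> nu A = \int[mu]_(x in A) (h x)%:E) ->
  measurable_fun setT f -> (forall x, 0 <= f x) ->
  \int[nu]_x f x = \int[mu]_x (f x * (h x)%:E).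
Proof.
move=> mh h0 nuE mf f0.
pose s := nnsfun_approx measurableT mf.
have mhE : measurable_fun setT (EFin \o h) by exact/measurable_EFinP.
have -> : \int[nu]_x f x = limn (fun n => \int[nu]_x (s n x)%:E).
  rewrite -monotone_convergence//.
  - by apply: eq_integral => x _; apply/esym/cvg_lim => //; exact: cvg_nnsfun_approx.
  - by move=> n; exact/measurable_EFinP.
  - by move=> n x _; rewrite lee_fin.
  - by move=> x _ a b ab; rewrite lee_fin; exact/lefP/nd_nnsfun_approx.
have -> : \int[mu]_x (f x * (h x)%:E) =
    limn (fun n => \int[mu]_x ((s n x)%:E * (h x)%:E)).
  rewrite -monotone_convergence//.
  - apply: eq_integral => x _; apply/esym/cvg_lim => //; apply: cvgeZr => //.
    exact: cvg_nnsfun_approx.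
  - by move=> n; apply: emeasurable_funM => //; exact/measurable_EFinP.
  - by move=> n x _; rewrite mule_ge0// lee_fin.
  - move=> x _ a b ab; apply: lee_wpmul2r; rewrite ?lee_fin//.
    exact/lefP/nd_nnsfun_approx.
congr (limn _); apply/funext => n.
have sE x : (s n x)%:E = \sum_(y \in range (s n)) (y%:E * (\1_(s n @^-1` [set y]) x)%:E).
  by rewrite [in LHS](fimfunE (s n) x) -fsumEFin.
have mi y : measurable_fun setT (fun x => (\1_(s n @^-1` [set y]) x)%:E : \bar R).
  exact/measurable_EFinP.
have sy0 y x : 0 <= y%:E * (\1_(s n @^-1` [set y]) x)%:E.
  exact: nnfun_muleindic_ge0.
have msy y : measurable_fun setT (fun x => y%:E * (\1_(s n @^-1` [set y]) x)%:E).
  by apply: emeasurable_funM.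
transitivity (\int[nu]_x (\sum_(y \in range (s n)) (y%:E * (\1_(s n @^-1` [set y]) x)%:E))).
  by apply: eq_integral => x _.
rewrite ge0_integral_fsum//.
transitivity (\int[mu]_x (\sum_(y \in range (s n))
    (y%:E * (\1_(s n @^-1` [set y]) x)%:E * (h x)%:E))); last first.
  apply: eq_integral => x _; rewrite sE ge0_mule_fsuml // => y; exact: sy0.
rewrite ge0_integral_fsum//; last 2 first.
- by move=> y; apply: emeasurable_funM.
- by move=> y x _; apply: mule_ge0; [exact: sy0|rewrite lee_fin].
apply: eq_fsbigr => y; rewrite inE => -[t _ <-].
have st0 : (0 <= s n t)%R by [].
rewrite ge0_integralZl_EFin//.
under [RHS]eq_integral do rewrite -muleA.
rewrite ge0_integralZl_EFin//; last 2 first.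
- by move=> x _; rewrite mule_ge0 ?lee_fin.
- by apply: emeasurable_funM.
congr (_ * _).
rewrite integral_indic// setIT nuE//.
rewrite integral_mkcond; apply: eq_integral => x _.
by rewrite patchE indicE; case: ifPn => _; rewrite ?mul1e ?mul0e.
Qed.

End lower_integral.

(** This produces both the members of a family from the base measure and the reweighting of [P] by
    one likelihood-ratio factor. *)
Lemma probability_of_density d (T : measurableType d) (R : realType)
    (mu : {measure set T -> \bar R}) (h : T -> R) :
  measurable_fun setT h -> (forall x, 0 <= h x) ->
  (\int[mu]_x (h x)%:E = 1)%E ->
  exists nu : probability T R,
    forall A, measurable A -> nu A = (\int[mu]_(x in A) (h x)%:E)%E.
Proof.
move=> mh h0 h1.
have [nu nuE] : {nu : set T -> \bar R |
    nu = fun A => (\int[mu]_(x in A) (h x)%:E)%E} by eexists.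
have nu0 : nu set0 = 0%E by rewrite nuE integral_set0.
have nu_ge0 A : (0 <= nu A)%E.
  by rewrite nuE; apply: integral_ge0 => x _; rewrite lee_fin.
have nu_sigma : semi_sigma_additive nu.
  move=> F mF tF mUF; apply: cvg_toP.
    apply: ereal_nondecreasing_is_cvgn => i j ij.
    by apply: lee_sum_nneg_natr => // k _ _; exact: nu_ge0.
  rewrite nuE ge0_integral_bigcup//=.
    by apply: measurable_funTS; exact/measurable_EFinP.
  by move=> x _; rewrite lee_fin.
pose mm := isMeasure.Build _ _ _ nu nu0 nu_ge0 nu_sigma.
pose mnu : {measure set T -> \bar R} := HB.pack nu mm.
have nu1 : mnu setT = 1%E by rewrite -h1 -[LHS]/(nu setT) nuE.
pose pm := Measure_isProbability.Build _ _ _ mnu nu1.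
pose pnu : probability T R := HB.pack nu mm pm.
by exists pnu => A mA; rewrite -[LHS]/(nu A) nuE.
Qed.

(** * Difference quotients *)

Section exp_quotient.
Context {R : realType}.
Implicit Types u x h : R.

(** The value 1 at 0 is the limit. It allows composition with increments of the log-partition
    function, which may vanish along the sequence. *)
Definition expq u : R := if u == 0 then 1 else (expR u - 1) / u.

Lemma expqE u : expR u - 1 = expq u * u.
Proof.
rewrite /expq; case: eqP => [->|/eqP u0]; first by rewrite expR0 mulr0 subrr.
by rewrite divfK.
Qed.

Lemma expq_dist u : u <= 2^-1 -> `|expq u - 1| <= 2 * `|u|.
Proof.
move=> u2; rewrite /expq; case: eqP => [->|/eqP u0]; first by rewrite subrr normr0 mulr0.
have lo : 0 <= expR u - 1 - u by have := expR_ge1Dx u; lra.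
have hi : expR u - 1 - u <= 2 * u ^+ 2.
  have u1 : 0 < 1 - u by lra.
  have e1 : expR u * (1 - u) <= 1.
    have := expR_ge1Dx (- u); rewrite expRN => /(ler_wpM2l (expR_ge0 u)).
    by rewrite mulfV ?expR_eq0.
  (* The previous bound gives (e^u - 1 - u) (1 - u) <= u^2, and 1 - u >= 1/2. *)
  nra.
have -> : (expR u - 1) / u - 1 = (expR u - 1 - u) / u by field.
rewrite normrM normfV ger0_norm// ler_pdivrMr ?normr_gt0//.
by rewrite -mulrA -expr2 real_normK ?num_real.
Qed.

Lemma cvg_expq (u : R^nat) : u @ \oo --> (0 : R) -> expq (u n) @[n --> \oo] --> (1 : R).
Proof.
move=> u0; apply/subr_cvg0; apply/cvgr0Pnorm_le => e e0.
have e2 : 0 < Num.min 2^-1 (e / 2) by rewrite lt_min invr_gt0 ltr0n divr_gt0.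
move/cvgr0Pnorm_le : u0 => /(_ _ e2); apply: filterS => n.
rewrite le_min => /andP[un1 un2].
rewrite (le_trans (expq_dist _))//; first by rewrite (le_trans (ler_norm _)).
by move: un2; rewrite ler_pdivlMr// mulrC.
Qed.

Definition halving h (n : nat) : R := h * 2^-1 ^+ n.

Lemma halving_neq0 h n : h != 0 -> halving h n != 0.
Proof. by move=> h0; rewrite mulf_neq0// expf_neq0// invr_neq0// pnatr_eq0. Qed.

Lemma cvg_halving h : halving h n @[n --> \oo] --> (0 : R).
Proof.
suff : halving h n @[n --> \oo] --> h * 0 by rewrite mulr0.
apply: cvgM; first exact: cvg_cst.
by apply: cvg_expr; rewrite ger0_norm ?invr_ge0// invf_lt1// ltr1n.
Qed.

Definition slope h x (n : nat) : R := (expR (halving h n * x) - 1) / halving h n.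

Lemma slopeE h x n : h != 0 -> slope h x n = expq (halving h n * x) * x.
Proof. by move=> h0; rewrite /slope expqE; field; exact: halving_neq0. Qed.

Lemma cvg_slope h x : h != 0 -> slope h x n @[n --> \oo] --> x.
Proof.
move=> h0; under eq_fun do rewrite slopeE//.
suff : expq (halving h n * x) * x @[n --> \oo] --> 1 * x by rewrite mul1r.
apply: cvgM; last exact: cvg_cst.
apply: cvg_expq; rewrite -(mul0r x); apply: cvgM; last exact: cvg_cst.
exact: cvg_halving.
Qed.

(* With u = e^(h x / 2), the slope difference h (q_h - q_(h/2)) is (u - 1)^2. *)
Lemma slope_nonincreasing h x m n : h != 0 -> (m <= n)%N ->
  h * slope h x n <= h * slope h x m.
Proof.
move=> h0 /subnK <-; elim: (n - m)%N => [//|k]; rewrite addSn; set j := (k + m)%N.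
move=> /(le_trans _); apply; rewrite -subr_ge0.
have hj0 : halving h j.+1 != 0 by exact: halving_neq0.
have hjE : halving h j = 2 * halving h j.+1.
  by rewrite /halving exprS; field.
have c0 : 0 < h / halving h j.+1.
  rewrite /halving invfM mulrA mulfV// mul1r invr_gt0 exprn_gt0//.
rewrite /slope hjE -mulrA expRM_natl; set u := expR _.
rewrite (_ : _ - _ = h / halving h j.+1 * (2^-1 * (u - 1) ^+ 2)); last by field.
by rewrite mulr_ge0 ?(ltW c0)// mulr_ge0 ?sqr_ge0// invr_ge0.
Qed.

Lemma cvg_derivative_within (Theta : set R) (f : R -> R) (x l : R) (u : R^nat) :
  has_derivative_within Theta f x l ->
  (forall n, Theta (x + u n)) -> (forall n, u n != 0) -> u @ \oo --> (0 : R) ->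
  (f (x + u n) - f x) / u n @[n --> \oo] --> l.
Proof.
move=> fl xu un0 u0.
have -> : (fun n => (f (x + u n) - f x) / u n) =
    (fun y => (f y - f x) / (y - x)) \o (fun n => x + u n).
  by apply/funext => n /=; rewrite addrAC subrr add0r.
apply: cvg_comp fl; move=> A /= [e /= e0 Ae].
move/cvgr0Pnorm_lt : u0 => /(_ _ e0); apply: filterS => n une.
apply: Ae => //=; first by rewrite opprD addrA subrr sub0r normrN.
by rewrite -subr_eq0 addrAC subrr add0r un0.
Qed.

Lemma derivative_within_continuous (Theta : set R) (f : R -> R) (x l : R) :
  has_derivative_within Theta f x l -> Theta x ->
  f y @[y --> within Theta (nbhs x)] --> f x.
Proof.
move=> fl Tx; apply/cvgrPdist_lt => e e0.
have l1 : 0 < `|l| + 1 by rewrite ltr_wpDl.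
have := fl; move/cvgrPdist_lt => /(_ 1 ltr01); rewrite /within /= /dnbhs /within /= => n1.
have n2 : \forall t \near x, `|x - t| < e / (`|l| + 1).
  by apply: nbhsx_ballx; rewrite divr_gt0.
rewrite near_withinE; near=> t => Tt; have [->|tx] := eqVneq t x; first by rewrite subrr normr0.
have tx0 : 0 < `|t - x| by rewrite normr_gt0 subr_eq0.
have : `|l - (f t - f x) / (t - x)| < 1 by move: Tt; move: tx; near: t; exact: n1.
move=> h1; have {}h1 : `|(f t - f x) / (t - x)| < `|l| + 1.
  rewrite -ltrBlDl; apply: le_lt_trans h1; rewrite distrC; exact: lerB_dist.
have h2 : `|x - t| < e / (`|l| + 1) by near: t.
rewrite distrC; move: h1; rewrite normrM normfV ltr_pdivrMr// => h1.
apply: (lt_trans h1); move: h2; rewrite ltr_pdivlMr// mulrC.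
by rewrite distrC.
Unshelve. all: by end_near. Qed.

End exp_quotient.

(** * Exponential families *)

Section affine_integral.
Context d (T : measurableType d) (R : realType) (nu : probability T R).
Variable f : T -> R.
Hypothesis fi : nu.-integrable setT (EFin \o f).

Lemma integrable_affine (h c : R) : nu.-integrable setT (fun x => (h * f x + c)%:E).
Proof.
have := integrableD measurableT (integrableZl measurableT h fi)
  (finite_measure_integrable_cst nu c measurableT).
by apply: eq_integrable => // x _ /=.
Qed.

Lemma integral_affine (h c mu : R) : (\int[nu]_x (f x)%:E = mu%:E)%E ->
  (\int[nu]_x (h * f x + c)%:E = (h * mu + c)%:E)%E.
Proof.
move=> imu; under eq_integral do rewrite EFinD EFinM.
rewrite integralD//; last 2 first.
- exact: integrableZl.
- exact: finite_measure_integrable_cst.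
rewrite integralZl// imu integral_cst// [X in (_ + _ * X)%E]probability_setT.
by rewrite mule1 -EFinM -EFinD.
Qed.

End affine_integral.

Section exponential_family_theory.
Context {R : realType}.
Local Notation law := (probability (measurableTypeR R) R).
Variables (m : {measure set (measurableTypeR R) -> \bar R}) (Theta : set R).
Hypothesis family : is_exp_family m Theta.
Local Notation b := (log_partition m).

Definition has_parameter (theta : R) (nu : law) : Prop :=
  forall A, measurable A ->
    nu A = (\int[m]_(x in A) (expR (x * theta - b theta))%:E)%E.

Let measurable_density theta :
  measurable_fun setT (fun x : measurableTypeR R => expR (x * theta - b theta)).
Proof.
apply: measurableT_comp => //; apply: measurable_funB => //.
exact: measurable_funM.
Qed.

Lemma expR_log_partition theta : Theta theta ->
  laplace m theta = (expR (b theta))%:E.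
Proof.
case: family => _ /[apply] /andP[L0 Ly].
have Lfin : laplace m theta \is a fin_num by rewrite ge0_fin_numE// ltW.
rewrite /log_partition lnK ?fineK// posrE fine_gt0//.
by rewrite L0.
Qed.

Lemma has_parameter_exists theta : Theta theta ->
  exists nu : law, has_parameter theta nu.
Proof.
move=> Tt; apply: probability_of_density => //.
under eq_integral do rewrite expRD mulrC EFinM.
rewrite ge0_integralZl_EFin//.
- rewrite -[X in (_ * X)%E]/(laplace m theta) expR_log_partition//.
  by rewrite -EFinM -expRD addNr expR0.
- by apply/measurable_EFinP; apply: measurableT_comp => //; exact: measurable_funM.
Qed.

Variables (theta theta' : R) (nu nu' : law).
Hypotheses (Tt : Theta theta) (Tt' : Theta theta').
Hypotheses (nut : has_parameter theta nu) (nut' : has_parameter theta' nu').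
(** The likelihood ratio of [nu'] with respect to [nu], that is, the quotient of their densities
    against [m]. *)
Let tilt (x : measurableTypeR R) : R := expR (x * (theta' - theta) - (b theta' - b theta)).

Let tilt0 x : 0 <= tilt x. Proof. exact: expR_ge0. Qed.

Let measurable_tilt : measurable_fun setT tilt.
Proof.
apply: measurableT_comp => //; apply: measurable_funB => //.
exact: measurable_funM.
Qed.

Lemma ge0_integral_tilt (f : measurableTypeR R -> \bar R) :
  measurable_fun setT f -> (forall x, 0 <= f x)%E ->
  (\int[nu']_x f x = \int[nu]_x (f x * (tilt x)%:E))%E.
Proof.
move=> mf f0.
rewrite (ge0_integral_density (measurable_density theta') _ nut')//.
have mt : measurable_fun setT (fun x => f x * (tilt x)%:E)%E.
  by apply: emeasurable_funM => //; exact/measurable_EFinP.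
have t0 x : (0 <= f x * (tilt x)%:E)%E by rewrite mule_ge0// lee_fin.
have := @ge0_integral_density _ _ _ m nu _ (fun x => f x * (tilt x)%:E)%E
  (measurable_density theta) (fun=> expR_ge0 _) nut mt t0.
move=> ->.
apply: eq_integral => x _; rewrite -muleA -EFinM -expRD; congr (_ * (expR _)%:E)%E.
ring.
Qed.

Lemma integrable_tilt (f : measurableTypeR R -> R) :
  nu'.-integrable setT (EFin \o f) ->
  nu.-integrable setT (EFin \o (fun x => f x * tilt x)).
Proof.
move=> /integrableP[mf fy]; have mf' := mf; move/measurable_EFinP : mf' => mf'.
apply/integrableP; split; first by apply/measurable_EFinP/measurable_funM.
move: fy; rewrite ge0_integral_tilt//; last exact: measurableT_comp.
by under eq_integral do rewrite /= -EFinM -(ger0_norm (tilt0 _)) -normrM.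
Qed.

Lemma integral_tilt (f : measurableTypeR R -> R) :
  nu'.-integrable setT (EFin \o f) ->
  (\int[nu']_x (f x)%:E = \int[nu]_x (f x * tilt x)%:E)%E.
Proof.
move=> fi; have mf := measurable_int _ fi.
rewrite integralE ge0_integral_tilt//; last exact: measurable_funepos.
rewrite ge0_integral_tilt//; last exact: measurable_funeneg.
rewrite [RHS]integralE; congr (_ - _)%E; apply: eq_integral => x _.
  by rewrite !funeposE EFinM maxe_pMl ?mul0e// lee_fin.
by rewrite !funenegE EFinM -mulNe maxe_pMl ?mul0e// lee_fin.
Qed.

Lemma integral_tilt1 : (\int[nu]_x (tilt x)%:E = 1)%E.
Proof.
transitivity (\int[nu]_x (1 * (tilt x)%:E))%E; first by under [RHS]eq_integral do rewrite mul1e.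
rewrite -(ge0_integral_tilt (f := fun=> 1%E))//.
by rewrite integral_cst// mul1e; exact: probability_setT.
Qed.

Lemma integrable_expR :
  nu.-integrable setT (fun x : measurableTypeR R => (expR ((theta' - theta) * x))%:E).
Proof.
have : nu.-integrable setT (EFin \o (fun x => tilt x)).
  apply/integrableP; split; first exact/measurable_EFinP.
  under eq_integral do rewrite /= ger0_norm//.
  by rewrite integral_tilt1 ltry.
move=> /(integrableZl measurableT (expR (b theta' - b theta))); apply: eq_integrable => //.
move=> x _ /=; rewrite -EFinM -expRD; congr (expR _)%:E; ring.
Qed.

Lemma integral_expR :
  (\int[nu]_x (expR ((theta' - theta) * x))%:E = (expR (b theta' - b theta))%:E)%E.
Proof.
transitivity (\int[nu]_x ((expR (b theta' - b theta))%:E * (tilt x)%:E))%E.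
  by apply: eq_integral => x _; rewrite -EFinM -expRD; congr (expR _)%:E; ring.
have mt : measurable_fun setT (fun x => (tilt x)%:E) by exact/measurable_EFinP.
have t0 x : (setT x -> 0 <= (tilt x)%:E)%E by rewrite lee_fin.
by rewrite (ge0_integralZl_EFin _ _ _ mt) ?expR_ge0// integral_tilt1 mule1.
Qed.

(** Jensen's inequality for the exponential: with h = theta' - theta, integrate e^(h x) >= e^(h mu)
    (1 + h (x - mu)) under [nu]. *)
Lemma log_partition_supporting_line (mu : R) :
  nu.-integrable setT (fun x : measurableTypeR R => x%:E) ->
  (\int[nu]_x x%:E = mu%:E)%E ->
  b theta + (theta' - theta) * mu <= b theta'.
Proof.
move=> idi imu; rewrite addrC -lerBrDr -ler_expR -lee_fin -integral_expR.
set h := theta' - theta.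
have li : nu.-integrable setT (fun x : measurableTypeR R =>
    (expR (h * mu) * h * x + expR (h * mu) * (1 - h * mu))%:E).
  exact: (integrable_affine idi).
apply: le_trans (le_integral measurableT li integrable_expR _); last first.
  move=> x _; rewrite lee_fin -mulrA -mulrDr -ler_pdivlMl ?expR_gt0//.
  rewrite -expRN -expRD.
  by have := expR_ge1Dx (- (h * mu) + h * x); lra.
by rewrite (integral_affine idi _ _ imu) lee_fin -mulrA -mulrDr addrC subrK mulr1.
Qed.

End exponential_family_theory.

Section linear_combination.
Context d (T : measurableType d) (R : realType).
Variable mu : {measure set T -> \bar R}.
Variables f g : T -> R.
Hypotheses (fi : mu.-integrable setT (EFin \o f)) (gi : mu.-integrable setT (EFin \o g)).

Lemma integrable_lin2 (a c : R) : mu.-integrable setT (fun x => (a * f x + c * g x)%:E).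
Proof.
have := integrableD measurableT (integrableZl measurableT a fi)
  (integrableZl measurableT c gi).
by apply: eq_integrable => // x _ /=.
Qed.

Lemma integral_lin2 (a c F G : R) : (\int[mu]_x (f x)%:E = F%:E)%E ->
  (\int[mu]_x (g x)%:E = G%:E)%E ->
  (\int[mu]_x (a * f x + c * g x)%:E = (a * F + c * G)%:E)%E.
Proof.
move=> fF gG; under eq_integral do rewrite EFinD 2!EFinM.
by rewrite integralD ?integralZl ?fF ?gG -?EFinM -?EFinD//; exact: integrableZl.
Qed.

End linear_combination.

(** * Moments of a member as derivatives of the log-partition function *)

Section moments.
Context {R : realType}.
Local Notation law := (probability (measurableTypeR R) R).
Variables (m : {measure set (measurableTypeR R) -> \bar R}) (Theta : set R).
Hypothesis family : is_exp_family m Theta.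
Local Notation b := (log_partition m).

Lemma halving_mem theta h n : Theta theta -> Theta (theta + h) ->
  Theta (theta + halving h n).
Proof.
move=> T1 T2; have c0 : 0 <= 2^-1 ^+ n :> R by rewrite exprn_ge0// invr_ge0.
have c1 : 2^-1 ^+ n <= 1 :> R by rewrite exprn_ile1// ?invr_ge0// invf_le1// ler1n.
have [h0|h0] := leP 0 h.
  by apply: (family.1 _ _ T1 T2); rewrite /halving; nra.
by apply: (family.1 _ _ T2 T1); rewrite /halving; nra.
Qed.

Section one_member.
Variables (theta h l : R) (nu : law).
Hypotheses (Tt : Theta theta) (Th : Theta (theta + h)) (h0 : h != 0).
Hypothesis nut : has_parameter m theta nu.
Hypothesis bl : has_derivative_within Theta b theta l.

Let beta n := b (theta + halving h n) - b theta.

Lemma cvg_log_partition_quotient : beta n / halving h n @[n --> \oo] --> l.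
Proof.
apply: (cvg_derivative_within bl) => [n|n|].
- exact: halving_mem.
- exact: halving_neq0.
- exact: cvg_halving.
Qed.

Lemma cvg_log_partition_diff : beta n @[n --> \oo] --> (0 : R).
Proof.
rewrite (_ : beta = fun n => beta n / halving h n * halving h n); last first.
  by apply/funext => n; rewrite divfK ?halving_neq0.
rewrite -(mulr0 l); apply: cvgM; last exact: cvg_halving.
exact: cvg_log_partition_quotient.
Qed.

Lemma cvg_laplace_ratio : expR (beta n) @[n --> \oo] --> (1 : R).
Proof.
rewrite (_ : (fun n => _) = fun n => 1 + expq (beta n) * beta n); last first.
  by apply/funext => n; rewrite -expqE addrC subrK.
suff : 1 + expq (beta n) * beta n @[n --> \oo] --> (1 + 1 * 0 : R) by rewrite mulr0 addr0.
apply: cvgD; first exact: cvg_cst.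
apply: cvgM; last exact: cvg_log_partition_diff.
exact/cvg_expq/cvg_log_partition_diff.
Qed.

Lemma cvg_laplace_quotient : (expR (beta n) - 1) / halving h n @[n --> \oo] --> l.
Proof.
rewrite (_ : (fun n => _) = fun n => expq (beta n) * (beta n / halving h n)); last first.
  by apply/funext => n; rewrite expqE mulrA.
rewrite -(mul1r l); apply: cvgM; last exact: cvg_log_partition_quotient.
exact/cvg_expq/cvg_log_partition_diff.
Qed.

Let integral_exp n :
  nu.-integrable setT (EFin \o (fun x : measurableTypeR R => expR (halving h n * x))) /\
  (\int[nu]_x (expR (halving h n * x))%:E = (expR (beta n))%:E)%E.
Proof.
have Tn := halving_mem n Tt Th.
have [nu' nut'] := has_parameter_exists family Tn.
have := integrable_expR nut nut'; have := integral_expR nut nut'.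
by rewrite (_ : theta + halving h n - theta = halving h n)//; ring.
Qed.

Let integral_slope n :
  nu.-integrable setT (EFin \o (fun x : measurableTypeR R => slope h x n)) /\
  (\int[nu]_x (slope h x n)%:E = ((expR (beta n) - 1) / halving h n)%:E)%E.
Proof.
have [ei eE] := integral_exp n; have hn0 := halving_neq0 n h0.
have sE x : slope h x n = (halving h n)^-1 * expR (halving h n * x) + - (halving h n)^-1.
  by rewrite /slope; field.
split.
  by apply: eq_integrable (integrable_affine ei _ _) => // x _ /=; rewrite sE.
under eq_integral do rewrite sE.
by rewrite (integral_affine ei _ _ eE); congr (_%:E); field.
Qed.

(* Monotone convergence of the difference quotients along h, h / 2, h / 4, etc.
   This is one-sided, hence also covers an endpoint of Theta, where the
   integrability of x follows from the finiteness of the derivative. *)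
Lemma mean_log_partition :
  nu.-integrable setT (fun x : measurableTypeR R => x%:E) /\
  (\int[nu]_x x%:E = l%:E)%E.
Proof.
pose Q n := (expR (beta n) - 1) / halving h n.
have si n := (integral_slope n).1; have sE n := (integral_slope n).2.
(* The drop of the quotients since n = 0, multiplied by h, is nonnegative and nondecreasing in n for
   either sign of h, as monotone convergence requires. *)
pose g n (x : measurableTypeR R) := h * slope h x 0 + (- h) * slope h x n.
have gi n : nu.-integrable setT (EFin \o g n) by exact: integrable_lin2.
have gE n : (\int[nu]_x (g n x)%:E = (h * Q 0 + (- h) * Q n)%:E)%E.
  exact: integral_lin2.
pose G (x : measurableTypeR R) := h * slope h x 0 + (- h) * x.
have g0 n x : 0 <= g n x by rewrite /g mulNr subr_ge0 slope_nonincreasing.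
have gG x : g n x @[n --> \oo] --> G x.
  by apply: cvgD; [exact: cvg_cst|apply: cvgM; [exact: cvg_cst|exact: cvg_slope]].
have G0 x : 0 <= G x by apply: (cvgr_to_ge (gG x)); apply: nearW => n; exact: g0.
have GE : (\int[nu]_x (G x)%:E = (h * Q 0 + (- h) * l)%:E)%E.
  transitivity (\int[nu]_x (limn (fun n => (g n x)%:E)))%E.
    apply: eq_integral => x _; apply/esym/cvg_lim => //; apply: cvg_EFin => //.
      exact: nearW.
    exact: gG.
  rewrite monotone_convergence//; last 3 first.
  - by move=> n; exact: measurable_int (gi n).
  - by move=> n x _; rewrite lee_fin.
  - by move=> x _ i j ij; rewrite lee_fin lerD2l !mulNr lerN2 slope_nonincreasing.
  apply/cvg_lim => //; under eq_fun do rewrite gE.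
  apply: cvg_EFin; first exact: nearW.
  apply: cvgD; [exact: cvg_cst|apply: cvgM; [exact: cvg_cst|]].
  exact: cvg_laplace_quotient.
have mG : measurable_fun setT (EFin \o G).
  apply/measurable_EFinP/measurable_funD; last exact: measurable_funM.
  apply: measurable_funM => //; apply/measurable_EFinP; exact: measurable_int (si 0).
have Gi : nu.-integrable setT (EFin \o G).
  apply/integrableP; split=> //.
  under eq_integral do rewrite /= ger0_norm//.
  by rewrite GE ltry.
have idE x : x = 1 * slope h x 0 + (- h^-1) * G x by rewrite /G; field.
split.
  apply: eq_integrable (integrable_lin2 (si 0) Gi 1 (- h^-1)) => // x _ /=.
  by rewrite -idE.
under eq_integral do rewrite [X in X%:E]idE.
by rewrite (integral_lin2 (si 0) Gi _ _ (sE 0) GE) -/(Q 0); congr (_%:E); field.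
Qed.

End one_member.
End moments.

Section variance_kl.
Context {R : realType}.
Local Notation law := (probability (measurableTypeR R) R).
Variables (m : {measure set (measurableTypeR R) -> \bar R}) (Theta : set R).
Hypothesis family : is_exp_family m Theta.
Local Notation b := (log_partition m).
Implicit Types (x h : R) (n : nat).

Lemma slope_sandwich h x : 0 < h -> x <= slope h x 0 /\ slope (- h) x 0 <= x.
Proof.
move=> h0; rewrite /slope /halving expr0 !mulr1; split.
  by rewrite ler_pdivlMr//; have := expR_ge1Dx (h * x); lra.
rewrite invrN mulrN -mulNr ler_pdivrMr//.
by have := expR_ge1Dx (- h * x); lra.
Qed.

Lemma expq_ge0 (u : R) : 0 <= expq u.
Proof.
rewrite /expq; case: eqP => // /eqP u0.
have [u1|u1] := leP 0 u.
  by rewrite divr_ge0// subr_ge0 -expR0 ler_expR.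
by rewrite mulr_le0// ?subr_le0 -?expR0 ?ler_expR ?invr_le0 ltW.
Qed.

Lemma mul_slope_ge0 h x n : h != 0 -> 0 <= x * slope h x n.
Proof. by move=> h0; rewrite slopeE// mulrCA mulr_ge0// ?expq_ge0// -expr2 sqr_ge0. Qed.

(** The dominating function for the second moment. For x >= 0 the quotients decrease from
    [slope h x 0]; for x < 0 they stay above x, hence above [slope (- h) x 0]. The remaining product
    is nonnegative in both cases. *)
Lemma mul_slope_bound h x n : 0 < h ->
  x * slope h x n <= x * slope h x 0 + x * slope (- h) x 0.
Proof.
move=> h0; have hn0 : h != 0 by rewrite gt_eqF.
have [s1 s2] := slope_sandwich x h0.
have [x0|x0] := leP 0 x.
  rewrite ler_wpDr//; first by rewrite mul_slope_ge0// oppr_eq0.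
  by rewrite ler_wpM2l// -(ler_pM2l h0) slope_nonincreasing.
rewrite ler_wpDl//; first by rewrite mul_slope_ge0.
rewrite ler_nM2l//; apply: (le_trans s2).
have hh : 0 < halving h n by rewrite /halving mulr_gt0// exprn_gt0// invr_gt0.
rewrite /slope ler_pdivlMr//; have := expR_ge1Dx (halving h n * x); lra.
Qed.

Variables (b1 : R -> R).
Hypothesis bb1 : forall theta, Theta theta -> has_derivative_within Theta b theta (b1 theta).

Section shifted.
Variables (theta h : R) (nu : law).
Hypotheses (Tt : Theta theta) (Th : Theta (theta + h)) (h0 : h != 0).
Hypothesis nut : has_parameter m theta nu.

(** This is the mean of the member at theta + h, transported to [nu] by the likelihood ratio. The
    mean identity at theta + h uses the step - h, which leads back to theta. *)
Lemma integral_id_expR :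
  nu.-integrable setT (EFin \o (fun x : measurableTypeR R => x * expR (h * x))) /\
  (\int[nu]_x (x * expR (h * x))%:E =
     (expR (b (theta + h) - b theta) * b1 (theta + h))%:E)%E.
Proof.
have [nu' nut'] := has_parameter_exists family Th.
have Th' : Theta (theta + h + (- h)) by rewrite addrK.
have nh0 : - h != 0 by rewrite oppr_eq0.
have [i1 i2] := mean_log_partition family Th Th' nh0 nut' (bb1 Th).
have ti := integrable_tilt nut nut' i1; have := integral_tilt nut nut' i1.
rewrite i2 => iE.
have e x : x * expR (h * x) = expR (b (theta + h) - b theta) *
    (x * expR (x * (theta + h - theta) - (b (theta + h) - b theta))).
  by rewrite mulrCA -expRD; congr (_ * expR _); ring.
split.
  apply: eq_integrable (integrableZl measurableT (expR (b (theta + h) - b theta)) ti) => //.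
  by move=> x _ /=; rewrite e.
under eq_integral do rewrite e EFinM.
by rewrite integralZl// -iE EFinM.
Qed.

End shifted.

Section interior.
Variables (theta h l : R) (nu : law).
Hypotheses (Tt : Theta theta) (Th : Theta (theta + h)) (Tnh : Theta (theta - h)).
Hypotheses (h0 : 0 < h) (nut : has_parameter m theta nu).
Hypothesis b1l : has_derivative_within Theta b1 theta l.

Let hn0 : h != 0. Proof. by rewrite gt_eqF. Qed.
Let beta n := b (theta + halving h n) - b theta.

Let mean_theta : nu.-integrable setT (fun x : measurableTypeR R => x%:E) /\
  (\int[nu]_x x%:E = (b1 theta)%:E)%E.
Proof. exact: (mean_log_partition family Tt Th hn0 nut (bb1 Tt)). Qed.

Let integral_mul_slope k n : k != 0 -> Theta (theta + k) ->
  nu.-integrable setT (EFin \o (fun x : measurableTypeR R => x * slope k x n)) /\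
  (\int[nu]_x (x * slope k x n)%:E =
    ((expR (b (theta + halving k n) - b theta) * b1 (theta + halving k n) - b1 theta)
      / halving k n)%:E)%E.
Proof.
move=> k0 Tk; have Tn := halving_mem family n Tt Tk.
have kn0 := halving_neq0 n k0.
have [ei eE] := integral_id_expR Tt Tn kn0 nut.
have [xi xE] := mean_theta.
have sE x : x * slope k x n =
    (halving k n)^-1 * (x * expR (halving k n * x)) + (- (halving k n)^-1) * x.
  by rewrite /slope; field.
split.
  by apply: eq_integrable (integrable_lin2 ei xi _ _) => // x _ /=; rewrite sE.
under eq_integral do rewrite sE.
by rewrite (integral_lin2 ei xi _ _ eE xE); congr (_%:E); field.
Qed.

(** As n grows, [x * slope h x n] is monotone in opposite directions for x > 0 and x < 0, so
    dominated convergence is used, at the price of a step on both sides of theta. Interior points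
    are enough for the mean value theorem. *)
Lemma second_moment_log_partition :
  nu.-integrable setT (EFin \o (fun x : measurableTypeR R => x * x)) /\
  (\int[nu]_x (x * x)%:E = (l + b1 theta ^+ 2)%:E)%E.
Proof.
have n0 : - h != 0 by rewrite oppr_eq0.
have si n := (integral_mul_slope n hn0 Th).1.
have sE n := (integral_mul_slope n hn0 Th).2.
have s'i := (integral_mul_slope 0 n0 Tnh).1.
pose g (x : measurableTypeR R) := 1 * (x * slope h x 0) + 1 * (x * slope (- h) x 0).
have gi : nu.-integrable setT (EFin \o g) by exact: integrable_lin2.
have mxx : measurable_fun setT (fun x : measurableTypeR R => (x * x)%:E).
  by apply/measurable_EFinP/measurable_funM.
have cvx x : (x * slope h x n)%:E @[n --> \oo] --> (x * x)%:E.
  apply: cvg_EFin; first exact: nearW.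
  by apply: cvgM; [exact: cvg_cst|exact: cvg_slope].
have bound x n : (`|(x * slope h x n)%:E| <= (g x)%:E)%E.
  by rewrite /= lee_fin ger0_norm ?mul_slope_ge0// /g !mul1r mul_slope_bound.
have [xxi _ cv] : [/\ nu.-integrable setT (EFin \o (fun x : measurableTypeR R => x * x)),
    True & (\int[nu]_x (x * slope h x n)%:E)%E @[n --> \oo] --> (\int[nu]_x (x * x)%:E)%E].
  have [] := @dominated_convergence _ _ _ nu setT measurableT
    (fun n x => (x * slope h x n)%:E) (fun x => (x * x)%:E) (EFin \o g) _ mxx _ gi _.
  - by move=> n; exact: measurable_int (si n).
  - by apply: aeW => x _; exact: cvx.
  - by apply: aeW => x n _; exact: bound.
  - by [].
split; first exact: xxi.
suff cvR : (expR (beta n) * b1 (theta + halving h n) - b1 theta) / halving h n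
    @[n --> \oo] --> l + b1 theta ^+ 2.
  apply: (cvg_unique _ cv) => //=; under eq_fun do rewrite sE.
  by apply: cvg_EFin; [exact: nearW|exact: cvR].
(* The product rule in discrete form, for the derivative at theta of exp(b - b theta) b'. *)
rewrite (_ : (fun n => _) = fun n => expR (beta n) *
    ((b1 (theta + halving h n) - b1 theta) / halving h n) +
    b1 theta * ((expR (beta n) - 1) / halving h n)); last first.
  by apply/funext => n; rewrite -/(beta n); field; exact: halving_neq0.
rewrite expr2 -[l]mul1r; apply: cvgD; apply: cvgM.
- exact: (cvg_laplace_ratio family Tt Th hn0 (bb1 Tt)).
- apply: (cvg_derivative_within b1l) => [n|n|].
  + exact: (halving_mem family).
  + exact: halving_neq0.
  + exact: cvg_halving.
- exact: cvg_cst.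
- exact: (cvg_laplace_quotient family Tt Th hn0 (bb1 Tt)).
Qed.

Lemma var_log_partition : var nu = l.
Proof.
have [xi xE] := mean_theta.
have [xxi xxE] := second_moment_log_partition.
rewrite /var /variance covariance.unlock expectation.unlock /= xE /=.
set c := b1 theta.
have e x : (x - c) * (x - c) = 1 * (x * x) + 1 * (- (2 * c) * x + c ^+ 2) by ring.
transitivity (fine (\int[nu]_x (1 * (x * x) + 1 * (- (2 * c) * x + c ^+ 2))%:E)).
  by congr fine; apply: eq_integral => x _; rewrite -e.
rewrite (integral_lin2 xxi (integrable_affine xi _ _) _ _ xxE (integral_affine xi _ _ xE)) /=.
by rewrite -/c; ring.
Qed.

End interior.

Section kullback_leibler.
Variables (theta theta' mu : R) (nu nu' : law).
Hypotheses (nut : has_parameter m theta nu) (nut' : has_parameter m theta' nu').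
Hypothesis idi : nu.-integrable setT (fun x : measurableTypeR R => x%:E).
Hypothesis idE : (\int[nu]_x x%:E = mu%:E)%E.

(** The Radon-Nikodym derivative equals the explicit likelihood ratio [nu']-almost everywhere, hence
    [nu]-almost everywhere by domination. Its logarithm is affine in x, so only the mean of [nu]
    enters. *)
Lemma KL_log_partition :
  KL nu nu' = ((theta - theta') * mu - (b theta - b theta'))%:E.
Proof.
pose t (x : measurableTypeR R) := expR (x * (theta - theta') - (b theta - b theta')).
have mt : measurable_fun setT (EFin \o t).
  apply/measurable_EFinP; apply: measurableT_comp => //; apply: measurable_funB => //.
  exact: measurable_funM.
have nuE A : measurable A -> nu A = (\int[nu']_(x in A) (t x)%:E)%E.
  move=> mA.
  transitivity (\int[nu]_x (\1_A x)%:E)%E; first by rewrite integral_indic// setIT.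
  rewrite (ge0_integral_tilt nut' nut (f := fun x => (\1_A x)%:E)); last 2 first.
  - by apply/measurable_EFinP.
  - by move=> x; rewrite lee_fin.
  rewrite [RHS]integral_mkcond; apply: eq_integral => x _.
  by rewrite patchE indicE; case: ifPn => _; rewrite ?mul1e ?mul0e.
have dom : nu `<< nu'.
  apply/null_content_dominatesP => A mA A0; rewrite nuE//.
  by apply: null_set_integral => //; exact: measurable_funTS.
rewrite /KL asboolT// expectation.unlock.
set f := Radon_Nikodym _ _.
have fi : nu'.-integrable setT f by apply: Radon_Nikodym_integrable.
have ft : ae_eq nu' setT f (EFin \o t).
  apply: integral_ae_eq => // A _ mA.
  by rewrite -Radon_Nikodym_integral//= -nuE.
have ft' : ae_eq nu setT f (EFin \o t).
  case: ft => N [mN N0 sN]; exists N; split => //.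
  by move/null_content_dominatesP : dom; apply.
transitivity (\int[nu]_x ((theta - theta') * x + - (b theta - b theta'))%:E)%E; last first.
  by rewrite (integral_affine idi _ _ idE).
apply: ae_eq_integral => //.
- apply/measurable_EFinP; apply: measurableT_comp => //.
  by apply: measurableT_comp => //; exact: measurable_int fi.
- apply/measurable_EFinP; apply: measurable_funD => //.
- apply: filterS ft' => x /(_ Logic.I) /= fx _; rewrite /= fx /= /t expRK.
  by rewrite mulrC.
Qed.

End kullback_leibler.
End variance_kl.

(** * Calculus with derivatives relative to an interval *)

Section calculus_within.
Context {R : realType}.
Implicit Types (Theta : set R) (f df : R -> R) (a c x : R).

Lemma derivative_within_is_derive Theta f x l :
  has_derivative_within Theta f x l -> (\forall y \near x, Theta y) ->
  is_derive x 1 f l.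
Proof.
move=> fl Tx.
have cv : h^-1 *: ((f \o shift x) (h *: 1) - f x) @[h --> 0^'] --> l.
  apply/cvgrPdist_lt => e e0; move/cvgrPdist_lt : fl => /(_ e e0) fl.
  have : \forall y \near x, y != x -> `|l - (f y - f x) / (y - x)| < e.
    move: fl Tx; rewrite /within /= /dnbhs /within /= => fl Tx.
    by near=> y => yx; (have Ty : Theta y by near: y); move: Ty; move: yx; near: y.
  move=> [d /= d0 dP]; exists d => //= h /= hd h0.
  have -> : h^-1 *: (f (h *: 1 + x) - f x) = (f (h + x) - f x) / h.
    by rewrite [h *: 1]mulr1 [_ *: _]mulrC.
  have := dP (h + x); rewrite /ball_ /= addrK; apply.
    move: hd; rewrite sub0r normrN => hd.
    by rewrite opprD addrCA subrr addr0 normrN.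
  by rewrite -subr_eq0 addrK.
split; first by apply/cvg_ex; exists l.
exact/cvg_lim.
Unshelve. all: by end_near. Qed.

Lemma derivative_within_itv_continuous Theta f df a c :
  (forall x, Theta x -> has_derivative_within Theta f x (df x)) ->
  `[a, c] `<=` Theta -> {within `[a, c], continuous f}.
Proof.
move=> fdf acT; apply/subspace_continuousP => x xac.
have := derivative_within_continuous (fdf x (acT _ xac)) (acT _ xac).
move=> cv P /cv; rewrite /within /nbhs /= => nP.
by apply: filterS nP => y h yac; apply: h; exact: acT.
Qed.

Lemma MVT_within Theta f df a c :
  (forall x, Theta x -> has_derivative_within Theta f x (df x)) ->
  `[a, c] `<=` Theta -> a < c ->
  exists2 x, x \in `]a, c[ & f c - f a = df x * (c - a).
Proof.
move=> fdf acT ac; apply: MVT => //; last exact: (derivative_within_itv_continuous fdf).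
move=> x xac; apply: (derivative_within_is_derive (fdf _ _)).
  by apply: acT; apply: subset_itv_oo_cc.
have : \forall y \near x, y \in `]a, c[ by exact: near_in_itvoo.
by apply: filterS => y yac; apply: acT; exact: subset_itv_oo_cc.
Qed.

End calculus_within.

Lemma supporting_line_KL (R : realType) (p q s t x : R) :
  p + (t - s) * x <= q -> 0 <= (s - t) * x - (p - q).
Proof. lra. Qed.

(** The three-point identity of Bregman divergences: the right side minus the left side is exactly
    (u - t) (y - x). Here s, t, u are the parameters of the means x, y, z, and p, q, r the values of
    the log-partition function there. *)
Lemma pythagoras_algebra (R : realType) (p q r s t u x y : R) :
  0 <= (u - t) * (y - x) ->
  (s - t) * x - (p - q) + ((t - u) * y - (q - r)) <= (s - u) * x - (p - r).
Proof. lra. Qed.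

(** Chaining the supporting lines at s and at the midpoint parameter, with slopes x < w, gains (t -
    s) (w - x) / 2 over the single line at s. *)
Lemma strict_bregman_algebra (R : realType) (p q r s t x w : R) :
  p + ((s + t) / 2 - s) * x <= q -> q + (t - (s + t) / 2) * w <= r ->
  s < t -> x < w -> 0 < (s - t) * x - (p - r).
Proof.
move=> h1 h2 st xw; have : 0 < (t - s) * (w - x) by rewrite mulr_gt0 ?subr_gt0.
by lra.
Qed.

Section quadratic_bound_algebra.
Context {R : realType}.
Variables (c x y tx ty : R).
Hypothesis c0 : 0 < c.
Let mid := ty + (x - y) / (2 * c).

Let midE : (mid - ty) * (2 * c) = x - y.
Proof. by rewrite /mid addrAC subrr add0r divfK// gt_eqF// mulr_gt0. Qed.

Lemma midpoint_le : x <= y -> y - x <= c * (ty - tx) -> tx <= mid <= ty.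
Proof.
have c2 : 0 < 2 * c by rewrite mulr_gt0.
move=> xy lip; move: midE => e; apply/andP; split.
  rewrite -subr_ge0 -(pmulr_lge0 _ c2).
  rewrite (_ : (mid - tx) * (2 * c) = (mid - ty) * (2 * c) + 2 * (c * (ty - tx))); last by ring.
  by rewrite e; lra.
by rewrite -subr_le0 -(pmulr_lle0 _ c2) e subr_le0.
Qed.

Lemma midpoint_ge : y <= x -> x - y <= c * (tx - ty) -> ty <= mid <= tx.
Proof.
have c2 : 0 < 2 * c by rewrite mulr_gt0.
move=> xy lip; move: midE => e; apply/andP; split.
  by rewrite -subr_ge0 -(pmulr_lge0 _ c2) e subr_ge0.
rewrite -subr_le0 -(pmulr_lle0 _ c2).
rewrite (_ : (mid - tx) * (2 * c) = (mid - ty) * (2 * c) - 2 * (c * (tx - ty))); last by ring.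
by rewrite e; lra.
Qed.

Lemma midpoint_slope_le bm : x <= y -> y - bm <= c * (ty - mid) ->
  (x - y) * (bm - x) <= - (x - y) ^+ 2 / 2.
Proof.
move=> xy; rewrite (_ : c * (ty - mid) = - ((mid - ty) * (2 * c)) / 2); last by field.
rewrite midE => lip; have {}lip : 0 <= bm - x - (y - x) / 2 by lra.
by have := mulr_ge0 lip (_ : 0 <= y - x); rewrite subr_ge0 => /(_ xy); nra.
Qed.

Lemma midpoint_slope_ge bm : y <= x -> bm - y <= c * (mid - ty) ->
  (x - y) * (bm - x) <= - (x - y) ^+ 2 / 2.
Proof.
move=> yx; rewrite (_ : c * (mid - ty) = (mid - ty) * (2 * c) / 2); last by field.
rewrite midE => lip; have {}lip : 0 <= (y - x) / 2 - (bm - x) by lra.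
by have := mulr_ge0 lip (_ : 0 <= x - y); rewrite subr_ge0 => /(_ yx); nra.
Qed.

(** Chaining the supporting lines at [tx] and at [mid] gains (ty - mid) (bm - x): a displacement |x
    - y| / (2 c) times a change of slope of at least |x - y| / 2, whence the constant 4 c. *)
Lemma quadratic_bound p q r bm : p + (mid - tx) * x <= q -> q + (ty - mid) * bm <= r ->
  (x - y) * (bm - x) <= - (x - y) ^+ 2 / 2 ->
  (x - y) ^+ 2 / (4 * c) <= (tx - ty) * x - (p - r).
Proof.
move=> l2 l1 bmE.
have e : ty - mid = - (x - y) / (2 * c) by rewrite /mid; field; rewrite gt_eqF.
have : (x - y) ^+ 2 / (4 * c) <= (ty - mid) * (bm - x).
  have -> : (x - y) ^+ 2 / (4 * c) = (x - y) ^+ 2 / 2 / (2 * c).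
    by field; rewrite gt_eqF.
  have -> : (ty - mid) * (bm - x) = (- (x - y) * (bm - x)) / (2 * c) by rewrite e mulrAC.
  by rewrite ler_pM2r ?invr_gt0 ?mulr_gt0//; lra.
lra.
Qed.

End quadratic_bound_algebra.

(** * The family parametrized by its means *)

Section mean_parametrization.
Context {R : realType}.
Local Notation law := (probability (measurableTypeR R) R).
Variables (m : {measure set (measurableTypeR R) -> \bar R}) (Theta : set R).
Hypothesis family : is_exp_family m Theta.
Local Notation b := (log_partition m).
Variables (b1 b2 : R -> R).
Hypothesis bb1 : forall theta, Theta theta -> has_derivative_within Theta b theta (b1 theta).
Hypothesis b1b2 : forall theta, Theta theta -> has_derivative_within Theta b1 theta (b2 theta).
Hypothesis b2_gt0 : forall theta, Theta theta -> 0 < b2 theta.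
Variables t0 t1 : R.
Hypotheses (Tt0 : Theta t0) (Tt1 : Theta t1) (t01 : t0 != t1).

Lemma itv_subset theta theta' : Theta theta -> Theta theta' ->
  `[theta, theta'] `<=` Theta.
Proof. by move=> T T' x /=; rewrite in_itv /=; exact: family.1. Qed.

(** The mean identity needs a second point of [Theta] to step towards; at least one of [t0], [t1]
    differs from theta. *)
Lemma mean_has_parameter theta (nu : law) : Theta theta -> has_parameter m theta nu ->
  nu.-integrable setT (fun x : measurableTypeR R => x%:E) /\
  (\int[nu]_x x%:E = (b1 theta)%:E)%E.
Proof.
move=> Tt nut.
have [h h0 Th] : exists2 h, h != 0 & Theta (theta + h).
  have [e|ne] := eqVneq t0 theta.
    by exists (t1 - theta); [rewrite subr_eq0 -e eq_sym|rewrite addrC subrK].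
  by exists (t0 - theta); [rewrite subr_eq0|rewrite addrC subrK].
exact: (mean_log_partition family Tt Th h0 nut (bb1 Tt)).
Qed.

Lemma meanE theta (nu : law) : Theta theta -> has_parameter m theta nu ->
  mean nu = b1 theta.
Proof.
by move=> Tt nut; rewrite /mean expectation.unlock (mean_has_parameter Tt nut).2.
Qed.

Lemma b1_lt theta theta' : Theta theta -> Theta theta' -> theta < theta' ->
  b1 theta < b1 theta'.
Proof.
move=> T T' tt'; have sT := itv_subset T T'.
have [x xtt' e] := MVT_within b1b2 sT tt'.
rewrite -subr_gt0 e mulr_gt0 ?subr_gt0// b2_gt0//.
by apply: sT; exact: subset_itv_oo_cc.
Qed.

Lemma b1_le theta theta' : Theta theta -> Theta theta' ->
  (b1 theta <= b1 theta') = (theta <= theta').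
Proof.
move=> T T'; apply/idP/idP; first by apply: contraTT; rewrite -!ltNge; exact: b1_lt.
by rewrite le_eqVlt => /predU1P[->//|/b1_lt H]; rewrite ltW// H.
Qed.

Lemma b1_inj theta theta' : Theta theta -> Theta theta' ->
  b1 theta = b1 theta' -> theta = theta'.
Proof. by move=> T T' e; apply/eqP; rewrite eq_le -(b1_le T T') -(b1_le T' T) e lexx. Qed.

(** The inverse of b' on the mean space; an unspecified value elsewhere. *)
Definition param_of_mean (x : R) : R := get [set theta | Theta theta /\ b1 theta = x].
Local Notation tau := param_of_mean.

Lemma mean_spaceP (x : R) :
  mean_space m Theta x <-> exists2 theta, Theta theta & b1 theta = x.
Proof.
split.
  by move=> [nu [theta Tt nut] <-]; exists theta => //; rewrite (meanE Tt nut).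
move=> [theta Tt <-]; have [nu nut] := has_parameter_exists family Tt.
by exists nu; [exists theta|exact: meanE].
Qed.

Lemma param_of_meanP (x : R) : mean_space m Theta x -> Theta (tau x) /\ b1 (tau x) = x.
Proof.
move=> /mean_spaceP[theta Tt tx].
by apply: (@getPex _ [set theta | Theta theta /\ b1 theta = x]); exists theta.
Qed.

Lemma param_of_meanK theta : Theta theta -> tau (b1 theta) = theta.
Proof.
move=> Tt; have [|T e] := @param_of_meanP (b1 theta).
  by apply/mean_spaceP; exists theta.
exact: b1_inj.
Qed.

Lemma param_of_mean_le x y : mean_space m Theta x -> mean_space m Theta y ->
  (tau x <= tau y) = (x <= y).
Proof.
by move=> /param_of_meanP[Tx {2}<-] /param_of_meanP[Ty {2}<-]; rewrite b1_le.
Qed.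

Lemma exp_family_param (nu : law) : exp_family m Theta nu ->
  mean_space m Theta (mean nu) /\ has_parameter m (tau (mean nu)) nu.
Proof.
move=> [theta Tt nut]; split; first by exists nu => //; exists theta.
by rewrite (meanE Tt nut) param_of_meanK.
Qed.

Lemma member_of_meanP x : mean_space m Theta x ->
  has_parameter m (tau x) (member_of_mean m Theta x).
Proof.
move=> [nu nuF nux].
have [] := @getPex _ [set nu : law | exp_family m Theta nu /\ mean nu = x].
  by exists nu.
by rewrite -/(member_of_mean m Theta x) => /exp_family_param[_ +] e; rewrite e.
Qed.

Local Notation kl := (KL_mean m Theta).

Lemma KL_meanE x y : mean_space m Theta x -> mean_space m Theta y ->
  kl x y = (tau x - tau y) * x - (b (tau x) - b (tau y)).
Proof.
move=> Sx Sy; have [Tx e] := param_of_meanP Sx.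
have mx := member_of_meanP Sx; have [i1 i2] := mean_has_parameter Tx mx.
by rewrite /KL_mean (KL_log_partition mx (member_of_meanP Sy) i1 i2) /= e.
Qed.

Lemma supporting_line theta theta' : Theta theta -> Theta theta' ->
  b theta + (theta' - theta) * b1 theta <= b theta'.
Proof.
move=> T T'; have [nu nut] := has_parameter_exists family T.
have [nu' nut'] := has_parameter_exists family T'.
have [i1 i2] := mean_has_parameter T nut.
exact: (log_partition_supporting_line nut nut' i1 i2).
Qed.

Lemma KL_mean_ge0 x y : mean_space m Theta x -> mean_space m Theta y -> 0 <= kl x y.
Proof.
move=> Sx Sy; rewrite KL_meanE//.
have [Tx ex] := param_of_meanP Sx; have [Ty ey] := param_of_meanP Sy.
have := supporting_line Tx Ty; rewrite ex.
exact: supporting_line_KL.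
Qed.

Lemma KL_mean_pythagoras x y z : mean_space m Theta x -> mean_space m Theta y ->
  mean_space m Theta z -> 0 <= (z - y) * (y - x) ->
  kl x y + kl y z <= kl x z.
Proof.
move=> Sx Sy Sz h; rewrite !KL_meanE//.
apply: pythagoras_algebra.
have [yx|xy] := leP y x.
  have [->|yx'] := eqVneq y x; first by rewrite subrr mulr0.
  rewrite mulr_le0// subr_le0// param_of_mean_le// -subr_le0.
  by rewrite -(nmulr_lge0 (x := y - x)) ?subr_lt0 ?lt_neqAle ?yx' ?yx// mulrC.
rewrite mulr_ge0// subr_ge0 ?(ltW xy)// param_of_mean_le// -subr_ge0.
by rewrite -(pmulr_lge0 _ (x := y - x)) ?subr_gt0// mulrC.
Qed.

Lemma mean_space_between x y z : mean_space m Theta x -> mean_space m Theta z ->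
  x <= y <= z -> mean_space m Theta y.
Proof.
move=> Sx Sz /andP[xy yz].
have [Tx ex] := param_of_meanP Sx; have [Tz ez] := param_of_meanP Sz.
have txz : tau x <= tau z by rewrite param_of_mean_le// (le_trans xy).
have sT := itv_subset Tx Tz.
have [||t tI <-] := @IVT _ b1 (tau x) (tau z) y txz.
- exact: (derivative_within_itv_continuous b1b2).
- by rewrite ex ez ge_min le_max xy yz orbT.
by apply/mean_spaceP; exists t => //; exact: sT.
Qed.

Lemma KL_mean_gt0 x y : mean_space m Theta x -> mean_space m Theta y -> x < y ->
  0 < kl x y.
Proof.
move=> Sx Sy xy; have [Tx ex] := param_of_meanP Sx; have [Ty ey] := param_of_meanP Sy.
have txy : tau x < tau y by rewrite ltNge param_of_mean_le// -ltNge.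
pose mid := (tau x + tau y) / 2.
have Tm : Theta mid.
  by apply: (family.1 _ _ Tx Ty); rewrite !midf_le ?ltW.
have xm : x < b1 mid by rewrite -[x]ex b1_lt// midf_lt.
have := supporting_line Tx Tm; rewrite ex => l1.
rewrite KL_meanE//; exact: (strict_bregman_algebra l1 (supporting_line Tm Ty) txy xm).
Qed.

(** The integrand is the likelihood ratio of the member with mean z against [nu]. Its logarithm is
    affine in x with slope [tau z - tau (mean nu)] and equals [kl z (mean nu)] at x = z, so the sign
    of the slope settles each of the two tails. *)
Lemma KL_mean_chernoff (nu : law) z : exp_family m Theta nu -> mean_space m Theta z ->
  exists lam psi : R, [/\ (\int[nu]_x (expR (lam * x - psi))%:E = 1)%E,
    z <= mean nu -> forall x, x <= z -> kl z (mean nu) <= lam * x - psi &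
    mean nu <= z -> forall x, z <= x -> kl z (mean nu) <= lam * x - psi].
Proof.
move=> nuF Sz; have [Sm num] := exp_family_param nuF.
exists (tau z - tau (mean nu)), (b (tau z) - b (tau (mean nu))); split.
- rewrite -(integral_tilt1 num (member_of_meanP Sz)).
  by apply: eq_integral => x _; rewrite [x * _]mulrC.
- move=> zm x xz; rewrite KL_meanE// lerD2r ler_wnM2l// subr_le0.
  by rewrite param_of_mean_le.
- move=> mz x zx; rewrite KL_meanE// lerD2r ler_wpM2l// subr_ge0.
  by rewrite param_of_mean_le.
Qed.

(** The Chernoff bound needs a threshold that is itself the mean of a member. The intermediate value
    theorem provides it, applied along the parameter to a function that is [kl x y] at [tau x] and 0
    at [tau y]. *)
Lemma KL_mean_cut x y s : mean_space m Theta x -> mean_space m Theta y ->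
  x <= y -> 0 <= s <= kl x y ->
  exists z, [/\ mean_space m Theta z, z <= y & kl z y = s].
Proof.
move=> Sx Sy xy /andP[s0 sk].
have [Tx ex] := param_of_meanP Sx; have [Ty ey] := param_of_meanP Sy.
have txy : tau x <= tau y by rewrite param_of_mean_le.
have sT := itv_subset Tx Ty.
pose F t := (t - tau y) * b1 t - (b t - b (tau y)).
have [||t tI Ft] := @IVT _ F (tau x) (tau y) s txy.
- apply/subspace_continuousP => t tI.
  have c1 := (subspace_continuousP _ _).1 (derivative_within_itv_continuous b1b2 sT) t tI.
  have c0 := (subspace_continuousP _ _).1 (derivative_within_itv_continuous bb1 sT) t tI.
  apply: cvgB; last by apply: cvgB; [exact: c0|exact: cvg_cst].
  apply: cvgM; last exact: c1.
  by apply: cvgB; [exact: cvg_within|exact: cvg_cst].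
- rewrite /F ex -KL_meanE// (subrr (tau y)) mul0r !subrr.
  by rewrite ge_min le_max s0 sk orbT.
have Tt := sT _ tI; have St : mean_space m Theta (b1 t) by apply/mean_spaceP; exists t.
exists (b1 t); split => //.
  by rewrite -ey b1_le//; move: tI; rewrite in_itv => /andP[].
by rewrite (KL_meanE St Sy) (param_of_meanK Tt) -[RHS]Ft.
Qed.

Variables (M Vbar : R) (V : R -> R).
Hypothesis (Vbar_gt0 : 0 < Vbar) (V_le : forall mu, 0 < mu <= M -> V mu <= Vbar).
Hypothesis V_variance : is_variance_function m Theta V.

(** The mean value theorem gives b'' at an interior point x, where it is the variance of the member
    and so V (b1 x), with b1 x in (0, M] by monotonicity. The step h fits on both sides of x, as the
    variance identity requires. *)
Lemma b1_lipschitz theta theta' : Theta theta -> Theta theta' -> theta <= theta' ->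
  0 < b1 theta -> b1 theta' <= M -> b1 theta' - b1 theta <= Vbar * (theta' - theta).
Proof.
move=> T T'; rewrite le_eqVlt => /predU1P[->|tt' b1t b1t'].
  by rewrite !subrr mulr0.
have sT := itv_subset T T'.
have [x xtt' ->] := MVT_within b1b2 sT tt'.
rewrite ler_wpM2r ?subr_ge0 ?(ltW tt')//.
have [tx xt'] : theta < x /\ x < theta' by move: xtt'; rewrite in_itv /= => /andP.
have Tx : Theta x by apply: sT; exact: subset_itv_oo_cc.
have Sx : mean_space m Theta (b1 x) by apply/mean_spaceP; exists x.
have mx := member_of_meanP Sx; rewrite param_of_meanK// in mx.
pose h := Num.min (x - theta) (theta' - x).
have h0 : 0 < h by rewrite lt_min !subr_gt0 tx.
have hx : h <= x - theta by rewrite ge_min lexx.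
have hx' : h <= theta' - x by rewrite ge_min lexx orbT.
have Txh : Theta (x + h).
  apply: sT; rewrite /= in_itv /= -lerBrDl hx' andbT.
  by rewrite (le_trans (ltW tx))// lerDl ltW.
have Txnh : Theta (x - h).
  apply: sT; rewrite /= in_itv /= lerBrDl addrC -lerBrDl hx /=.
  by rewrite (le_trans _ (ltW xt'))// gerBl ltW.
rewrite -(var_log_partition family bb1 Tx Txh Txnh h0 mx (b1b2 Tx)) -V_variance//.
apply: V_le; rewrite (lt_trans b1t) ?b1_lt//=.
by rewrite (le_trans _ b1t')// ltW// b1_lt.
Qed.

(* At mid the mean has moved from y towards x by at most half of x - y, so the
   supporting line at mid separates the two linear bounds. *)
Lemma KL_mean_quadratic x y : mean_space m Theta x -> mean_space m Theta y ->
  0 < x <= M -> 0 < y <= M -> (x - y) ^+ 2 / (4 * Vbar) <= kl x y.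
Proof.
move=> Sx Sy /andP[x0 xM] /andP[y0 yM].
have [Tx ex] := param_of_meanP Sx; have [Ty ey] := param_of_meanP Sy.
rewrite KL_meanE//.
pose mid := tau y + (x - y) / (2 * Vbar).
suff [Tm bm] : Theta mid /\ (x - y) * (b1 mid - x) <= - (x - y) ^+ 2 / 2.
  have := supporting_line Tm Ty; have := supporting_line Tx Tm; rewrite ex => l1 l2.
  exact (quadratic_bound Vbar_gt0 l1 l2 bm).
have [xy|/ltW yx] := leP x y.
  have txy : tau x <= tau y by rewrite param_of_mean_le.
  have := b1_lipschitz Tx Ty txy; rewrite ex ey => /(_ x0 yM) lip.
  have /andP[xm my] := midpoint_le Vbar_gt0 xy lip.
  have Tm : Theta mid by apply: (family.1 _ _ Tx Ty); rewrite xm my.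
  have b1x : x <= b1 mid by rewrite -[x]ex b1_le.
  have := b1_lipschitz Tm Ty my; rewrite ey => /(_ (lt_le_trans x0 b1x) yM) lm.
  by split => //; exact (midpoint_slope_le Vbar_gt0 xy lm).
have tyx : tau y <= tau x by rewrite param_of_mean_le.
have := b1_lipschitz Ty Tx tyx; rewrite ex ey => /(_ y0 xM) lip.
have /andP[my xm] := midpoint_ge Vbar_gt0 yx lip.
have Tm : Theta mid by apply: (family.1 _ _ Ty Tx); rewrite my xm.
have b1x : b1 mid <= x by rewrite -[x]ex b1_le.
have := b1_lipschitz Ty Tm my; rewrite ey => /(_ y0 (le_trans b1x xM)) lm.
by split => //; exact (midpoint_slope_ge Vbar_gt0 yx lm).
Qed.

End mean_parametrization.

(** * The past of a bandit run *)

Lemma measurable_inv (R : realType) :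
  measurable_fun setT (GRing.inv : measurableTypeR R -> measurableTypeR R).
Proof.
rewrite -(setvU [set (0 : R)]); apply/measurable_funU => //; first exact: measurableC.
split; last exact: measurable_fun_set1.
apply: open_continuous_measurable_fun; first exact: closed_openC.
by move=> x; rewrite inE => x0; apply: inv_continuous; exact/eqP.
Qed.

Section bandit_past.
Context {R : realType} (K T : nat) (nu : 'I_K -> probability (measurableTypeR R) R).
Context {d : measure_display} {Omega : measurableType d}.
Variables (P : probability Omega R).
Variables (I : nat -> Omega -> 'I_K) (r : nat -> Omega -> R).
Variable p : nat -> 'I_K -> Omega -> R.
Hypothesis run : bandit_run nu T P I r p.

(** The generating family of [past], named so that the past becomes a measurable type and
    measurability with respect to it is an instance of [measurable_fun]. *)
Definition past_generators (t : nat) : set (set Omega) :=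
  [set E : set Omega | exists2 i, (1 <= i < t)%N &
    (exists a, E = [set w | I i w = a]) \/
    (exists2 B : set (measurableTypeR R), measurable B & E = r i @^-1` B)].

Local Notation pastT t := (g_sigma_algebraType (past_generators t)).

Lemma measurable_pastE t (E : set (pastT t)) : measurable E = past I r t E.
Proof. by []. Qed.

Lemma past_measurable t (E : set Omega) : (t <= T.+1)%N -> past I r t E -> measurable E.
Proof.
move=> tT; apply: smallest_sub; first exact: sigma_algebra_measurable.
move=> A [i /andP[i1 it]]; have iT : (1 <= i <= T)%N by rewrite i1 -ltnS (leq_trans it).
have [mI mr _ _] := run iT; case=> [[a ->]|[B mB ->]]; first exact: mI.
by rewrite -[_ @^-1` _]setTI; exact: mr.
Qed.

Lemma past_I t i a : (1 <= i < t)%N -> past I r t [set w | I i w = a].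
Proof. by move=> it; apply: sub_sigma_algebra; exists i => //; left; exists a. Qed.

Lemma past_r t i : (1 <= i < t)%N -> measurable_fun setT (r i : pastT t -> measurableTypeR R).
Proof.
move=> it _ B mB; rewrite setTI measurable_pastE.
by apply: sub_sigma_algebra; exists i => //; right; exists B.
Qed.

Lemma past_pulled t i a : (1 <= i < t)%N ->
  measurable_fun setT (fun w : pastT t => (I i w == a)%:R : R).
Proof.
move=> it; rewrite (_ : (fun _ => _) = \1_[set w : pastT t | I i w = a]).
  by apply: measurable_indic; rewrite measurable_pastE; exact: past_I.
apply/funext => w; rewrite indicE; congr (_%:R); congr nat_of_bool.
by apply/eqP/idP => [e|]; [rewrite inE|rewrite inE].
Qed.

Lemma past_pulls t n a : (n < t)%N ->
  measurable_fun setT (fun w : pastT t => (pulls I n a w)%:R : R).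
Proof.
move=> nt; under eq_fun do rewrite /pulls natr_sum.
have -> : (fun w : pastT t => \sum_(1 <= i < n.+1) (I i w == a)%:R : R) =
    (fun w => \sum_(i < n) (I i.+1 w == a)%:R).
  by apply/funext => w; rewrite big_add1 /= big_mkord.
apply: measurable_sum => i; apply: past_pulled => /=.
by rewrite (leq_ltn_trans _ nt).
Qed.

Lemma past_emp_mean t n a : (n < t)%N ->
  measurable_fun setT (fun w : pastT t => emp_mean I r n a w).
Proof.
move=> nt; apply: measurable_funM; last first.
  apply: (measurableT_comp (f := @GRing.inv R)); last exact: past_pulls.
  exact: measurable_inv.
have -> : (fun w : pastT t => \sum_(1 <= i < n.+1 | I i w == a) r i w) =
    (fun w => \sum_(i < n) (I i.+1 w == a)%:R * r i.+1 w).
  apply/funext => w; rewrite big_mkcond big_add1 /= big_mkord.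
  by apply: eq_bigr => i _; case: ifP; rewrite ?mul1r ?mul0r.
apply: measurable_sum => i; have it : (1 <= i.+1 < t)%N by rewrite /= (leq_ltn_trans _ nt).
by apply: measurable_funM; [exact: past_pulled|exact: past_r].
Qed.

Lemma pullsS n a w : pulls I n.+1 a w = (pulls I n a w + (I n.+1 w == a))%N.
Proof. by rewrite /pulls big_nat_recr. Qed.

Lemma pulls0 a w : pulls I 0 a w = 0%N.
Proof. by rewrite /pulls big_nil. Qed.

Lemma pulls_le n a w : (pulls I n a w <= n)%N.
Proof. by elim: n => [|n IH]; rewrite ?pulls0// pullsS -addn1 leq_add// leq_b1. Qed.

Lemma pulls_homo m n a w : (m <= n)%N -> (pulls I m a w <= pulls I n a w)%N.
Proof.
by move=> /subnK <-; elim: (n - m)%N => // k IH; rewrite addSn pullsS (leq_trans IH)// leq_addr.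
Qed.

Lemma past_pulls_eq t n a k : (n < t)%N -> past I r t [set w | pulls I n a w = k].
Proof.
move=> nt; have := past_pulls a nt measurableT (measurable_set1 (k%:R : R)).
rewrite setTI measurable_pastE; congr (past _ _ _ _).
by apply/seteqP; split => w /= => [/eqP|->//]; rewrite eqr_nat => /eqP.
Qed.

Lemma past_pulls_lt t n a k : (n < t)%N -> past I r t [set w | (pulls I n a w < k)%N].
Proof.
move=> nt; have := past_pulls a nt measurableT (measurable_itv `]-oo, (k%:R : R)[).
rewrite setTI measurable_pastE; congr (past _ _ _ _).
by apply/seteqP; split => w /=; rewrite in_itv /= ltr_nat.
Qed.

Lemma past_emp_mean_in t n a (B : set (measurableTypeR R)) : (n < t)%N -> measurable B ->
  past I r t [set w | B (emp_mean I r n a w)].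
Proof.
by move=> nt mB; have := past_emp_mean a nt measurableT mB; rewrite setTI measurable_pastE.
Qed.

Lemma pastI t E F : past I r t E -> past I r t F -> past I r t (E `&` F).
Proof. by rewrite -!measurable_pastE; exact: measurableI. Qed.

Lemma past_setT t : past I r t setT.
Proof. by rewrite -measurable_pastE; exact: measurableT. Qed.

Lemma pastC t E : past I r t E -> past I r t (~` E).
Proof. by rewrite -!measurable_pastE; exact: measurableC. Qed.

(** By the last clause of [bandit_run], the image under [r t] of [P] restricted to the event is
    [nu a] scaled by the probability of the event. *)
Lemma integral_reward t a F (g : R -> R) : (1 <= t <= T)%N -> past I r t F ->
  measurable_fun setT (g : measurableTypeR R -> R) -> (forall x, 0 <= g x) ->
  (\int[P]_(w in F `&` [set w | I t w = a]) (g (r t w))%:E =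
   P (F `&` [set w | I t w = a]) * \int[nu a]_x (g x)%:E)%E.
Proof.
move=> tT pF mg g0; have [mI mr _ rlaw] := run tT.
have mF : measurable F.
  by apply: past_measurable pF; case/andP: tT => _ tT; exact: leqW.
set E := F `&` _; have mE : measurable E by apply: measurableI => //; exact: mI.
have PE : P E \is a fin_num by exact: fin_num_measure.
have PE0 : 0 <= fine (P E) by rewrite fine_ge0.
pose mu : {measure set Omega -> \bar R} := mrestr P mE.
pose mu' : {measure set (measurableTypeR R) -> \bar R} := mscale (NngNum PE0) (nu a).
have mgE : measurable_fun setT (fun x : measurableTypeR R => (g x)%:E).
  exact/measurable_EFinP.
transitivity (\int[mu]_w (g (r t w))%:E)%E.
  have -> := @ge0_integral_density _ _ _ P mu (\1_E) (fun w => (g (r t w))%:E)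
    (measurable_indic mE) (fun=> ler0n _ _) _ (measurableT_comp mgE mr) (fun w => g0 _); last first.
    by move=> A mA; rewrite integral_indic// setIC.
  rewrite [LHS]integral_mkcond; apply: eq_integral => w _.
  by rewrite patchE indicE; case: ifPn => _; rewrite ?mule1 ?mule0.
transitivity (\int[pushforward mu (r t : Omega -> measurableTypeR R)]_x (g x)%:E)%E.
  by rewrite ge0_integral_pushforward// => x _; rewrite lee_fin.
rewrite (@eq_measure_integral _ _ _ _ mu'); last first.
  move=> B mB _; rewrite -[RHS]/((fine (P E))%:E * nu a B)%E fineK//.
  by rewrite -[LHS]/(P ((r t @^-1` B) `&` E)) setIC rlaw.
rewrite ge0_integral_mscale//= ?fineK// => x _; by rewrite lee_fin.
Qed.

End bandit_past.

Section indicator_sums.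
Context d (Omega : measurableType d) (R : realType) (P : probability Omega R).
Local Notation pr E := (fine (P E)).

Lemma prE (E : set Omega) : measurable E -> P E = (pr E)%:E.
Proof. by move=> mE; rewrite fineK// fin_num_measure. Qed.

Lemma pr_ge0 (E : set Omega) : 0 <= pr E.
Proof. by rewrite fine_ge0. Qed.

Section sums.
Variables (J : eqType) (E : J -> set Omega).

Lemma measurable_sum_indic (s : seq J) : (forall t, t \in s -> measurable (E t)) ->
  measurable_fun setT (fun w => \sum_(t <- s) \1_(E t) w : R).
Proof.
elim: s => [|t s IH] mE.
  by rewrite (_ : (fun _ => _) = cst 0)//; apply/funext => w; rewrite big_nil.
rewrite (_ : (fun _ => _) = \1_(E t) \+ (fun w => \sum_(u <- s) \1_(E u) w)); last first.
  by apply/funext => w; rewrite big_cons.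
apply: measurable_funD.
  by apply: measurable_indic; apply: mE; rewrite mem_head.
by apply: IH => u us; apply: mE; rewrite in_cons us orbT.
Qed.

Lemma integral_sum_indic (s : seq J) : (forall t, t \in s -> measurable (E t)) ->
  (\int[P]_w (\sum_(t <- s) \1_(E t) w)%:E = (\sum_(t <- s) pr (E t))%:E)%E.
Proof.
elim: s => [|t s IH] mE.
  by rewrite big_nil; under eq_integral do rewrite big_nil; exact: integral0.
have mt : measurable (E t) by apply: mE; rewrite mem_head.
have {}mE u : u \in s -> measurable (E u) by move=> us; apply: mE; rewrite in_cons us orbT.
rewrite big_cons; under eq_integral do rewrite big_cons EFinD.
rewrite ge0_integralD//; first last.
- by apply/measurable_EFinP; exact: measurable_sum_indic.
- by move=> w _; rewrite lee_fin sumr_ge0.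
- by apply/measurable_EFinP; exact: measurable_indic.
by rewrite IH// integral_indic// setIT EFinD -prE.
Qed.

(** Markov's inequality for a count of events; a single event gives the usual form. *)
Lemma sum_pr_le (s : seq J) (f : Omega -> R) (c C : R) :
  (forall t, t \in s -> measurable (E t)) -> 0 <= c -> measurable_fun setT f ->
  (forall w, c * \sum_(t <- s) \1_(E t) w <= f w) ->
  (\int[P]_w (f w)%:E <= C%:E)%E -> c * \sum_(t <- s) pr (E t) <= C.
Proof.
move=> mE c0 mf cf fC; rewrite -lee_fin; apply: le_trans fC.
have ms := measurable_sum_indic mE.
have s0 w : 0 <= \sum_(t <- s) \1_(E t) w :> R by rewrite sumr_ge0.
rewrite EFinM -integral_sum_indic// -ge0_integralZl_EFin//; last 2 first.
- by move=> w _; rewrite lee_fin.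
- exact/measurable_EFinP.
apply: ge0_le_integral => //.
- by move=> w _; rewrite -EFinM lee_fin mulr_ge0.
- by apply/measurable_EFinP; apply: measurable_funM.
- exact/measurable_EFinP.
- by move=> w _; rewrite -EFinM lee_fin.
Qed.

Lemma pr_ae_le_sum (A : set Omega) (s : seq J) : measurable A ->
  (forall t, t \in s -> measurable (E t)) ->
  {ae P, forall w, A w -> exists2 t, t \in s & E t w} ->
  pr A <= \sum_(t <- s) pr (E t).
Proof.
move=> mA mE AE; rewrite -lee_fin -prE// -integral_sum_indic//.
rewrite -[leLHS](_ : \int[P]_w (\1_A w)%:E = _)%E; last by rewrite integral_indic// setIT.
apply: ae_ge0_le_integral => //.
- by apply/measurable_EFinP; exact: measurable_indic.
- by move=> w _; rewrite lee_fin sumr_ge0.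
- by apply/measurable_EFinP; exact: measurable_sum_indic.
- apply: filterS AE => w AE _; rewrite lee_fin [in leLHS]indicE.
  case: (boolP (w \in A)) => [|_]; last by rewrite sumr_ge0.
  rewrite inE => /AE[t ts Et]; rewrite (big_rem t)//= indicE mem_set// lerDl.
  exact: sumr_ge0.
Qed.

End sums.

End indicator_sums.

(** * Chernoff bounds at random times *)

Section tilted_wealth.
Context {R : realType} (K T : nat) (nu : 'I_K -> probability (measurableTypeR R) R).
Context {d : measure_display} {Omega : measurableType d}.
Variables (P : probability Omega R).
Variables (I : nat -> Omega -> 'I_K) (r : nat -> Omega -> R).
Variable p : nat -> 'I_K -> Omega -> R.
Hypothesis run : bandit_run nu T P I r p.
Local Notation pastT t := (g_sigma_algebraType (past_generators I r t)).
Local Notation pr E := (fine (P E)).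

Lemma run_I_measurable t a : (1 <= t <= T)%N -> measurable [set w | I t w = a].
Proof. by move=> tT; have [] := run tT. Qed.

Lemma past_measurable_fun t (f : Omega -> R) : (t <= T.+1)%N ->
  measurable_fun setT (f : pastT t -> R) -> measurable_fun setT f.
Proof.
by move=> tT mf _ B mB; apply: (past_measurable run tT); exact: mf.
Qed.

(** The minimum with the pull count is what makes the induction go through; the bound by m is the
    part used afterwards. *)
Lemma sum_pulled_le m n a w :
  (\sum_(1 <= t < n.+1) ((pulls I t.-1 a w < m) && (I t w == a)) <= minn (pulls I n a w) m)%N.
Proof.
elim: n => [|n IH]; first by rewrite big_nil.
rewrite big_nat_recr//= pullsS (leq_trans (leq_add IH (leqnn _)))//.
case: (I n.+1 w == a); rewrite ?andbF ?andbT ?addn0//.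
by case: (ltnP (pulls I n a w) m) => h /=; rewrite ?addn0 ?addn1; lia.
Qed.

Lemma sum_pr_pulled m a :
  \sum_(1 <= t < T.+1) pr ([set w | (pulls I t.-1 a w < m)%N] `&` [set w | I t w = a]) <= m%:R.
Proof.
rewrite -[leLHS]mul1r.
apply: (sum_pr_le (f := fun=> m%:R)) => //.
- move=> t; rewrite mem_index_iota => /andP[t1 tT]; apply: measurableI.
    apply: (past_measurable run (t := t)); first exact: ltnW.
    by apply: past_pulls_lt; rewrite prednK.
  by apply: run_I_measurable; rewrite t1.
- move=> w; rewrite mul1r.
  have := leq_trans (sum_pulled_le m T a w) (geq_minr _ _); rewrite -(ler_nat R) natr_sum.
  apply: le_trans; apply: ler_sum => t _; rewrite indicE ler_nat.
  by case: (boolP (w \in _)) => //; rewrite inE => -[/= -> ->]; rewrite eqxx.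
- by rewrite integral_cst// [X in (_ * X)%E]probability_setT mule1.
Qed.

Variables (a : 'I_K) (lam psi : R).
Hypothesis mgf : (\int[nu a]_x (expR (lam * x - psi))%:E = 1)%E.
Variable k : nat.

(* The likelihood ratio of a tilted reward law for arm a, stopped after the k-th
   pull: its integral is 1 at every time, and from the k-th pull on it only
   depends on the first k rewards of the arm. *)
Definition step t w : R :=
  if (I t w == a) && (pulls I t.-1 a w < k)%N then expR (lam * r t w - psi) else 1.

Definition wealth n w : R := \prod_(1 <= i < n.+1) step i w.

Lemma wealthS n w : wealth n.+1 w = wealth n w * step n.+1 w.
Proof. by rewrite /wealth big_nat_recr. Qed.

Lemma wealth0 w : wealth 0 w = 1.
Proof. by rewrite /wealth big_nil. Qed.

Lemma step_ge0 t w : 0 <= step t w.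
Proof. by rewrite /step; case: ifP => // _; exact: expR_ge0. Qed.

Lemma wealth_ge0 n w : 0 <= wealth n w.
Proof. by apply: prodr_ge0 => t _; exact: step_ge0. Qed.

Lemma step_measurable t n : (1 <= n < t)%N -> measurable_fun setT (step n : pastT t -> R).
Proof.
move=> /andP[n1 nt].
have -> : (step n : pastT t -> R) = fun w => 1 + (I n w == a)%:R *
    (\1_[set w : pastT t | (pulls I n.-1 a w < k)%N] w * (expR (lam * r n w - psi) - 1)).
  apply/funext => w; rewrite /step indicE.
  case: eqP => _ /=; last by rewrite mul0r addr0.
  case: ifPn => pk; first by rewrite mem_set// !mul1r addrCA subrr addr0.
  by rewrite memNset ?mul0r ?mulr0 ?addr0//=; exact/negP.
apply: measurable_funD => //; apply: measurable_funM.
  by apply: past_pulled; rewrite n1.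
apply: measurable_funM.
  apply: measurable_indic; rewrite measurable_pastE; apply: past_pulls_lt.
  by rewrite (leq_ltn_trans (leq_pred _)).
apply: measurable_funB => //; apply: measurableT_comp => //; apply: measurable_funB => //.
by apply: measurable_funM => //; apply: past_r; rewrite n1.
Qed.

Lemma wealth_measurable t n : (n < t)%N -> measurable_fun setT (wealth n : pastT t -> R).
Proof.
elim: n => [|n IH] nt.
  by rewrite (_ : wealth 0 = cst 1)//; apply/funext => w; rewrite wealth0.
rewrite (_ : wealth n.+1 = fun w => wealth n w * step n.+1 w); last first.
  by apply/funext => w; rewrite wealthS.
by apply: measurable_funM; [apply: IH; exact: ltnW|exact: step_measurable].
Qed.

(** Given the past, a step has mean 1: on the event that [a] is pulled with fewer than k earlier
    pulls this is [mgf], and elsewhere the step is constantly 1. *)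
Lemma integral_step t E : (1 <= t <= T)%N -> past I r t E ->
  (\int[P]_(w in E) (step t w)%:E = P E)%E.
Proof.
move=> tT pE; have /andP[t1 t2] := tT.
have tT1 : (t <= T.+1)%N by rewrite leqW.
set F := [set w | (pulls I t.-1 a w < k)%N].
have pF : past I r t F by apply: past_pulls_lt; rewrite prednK.
have mE := past_measurable run tT1 pE; have mF := past_measurable run tT1 pF.
have mI : measurable [set w | I t w = a] by exact: run_I_measurable.
set A := E `&` F `&` [set w | I t w = a].
have mA : measurable A by apply: measurableI => //; exact: measurableI.
have mst : measurable_fun setT (step t).
  by apply: (@past_measurable_fun T.+1) => //; apply: step_measurable; rewrite t1 ltnS.
have AE : A `<=` E by move=> w [[]].
have EA : E = A `|` (E `\` A) by rewrite setDUK.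
have mEA : measurable (E `\` A) by exact: measurableD.
have dA : [disjoint A & E `\` A] by apply/disj_set2P; rewrite setDIK.
rewrite {1}EA ge0_integral_setU//; last 2 first.
- by rewrite -EA; apply/measurable_EFinP; exact: measurable_funTS.
- by move=> w _; rewrite lee_fin step_ge0.
have -> : (\int[P]_(w in A) (step t w)%:E = P A)%E.
  rewrite (eq_integral (fun w => (expR (lam * r t w - psi))%:E)); last first.
    by move=> w; rewrite inE => -[[_ /= wk] /= Iw]; rewrite /step Iw eqxx wk.
  rewrite (integral_reward (g := fun x => expR (lam * x - psi)) run a tT (pastI pE pF)).
  - by rewrite mgf mule1.
  - apply: measurableT_comp => //; apply: measurable_funB => //.
  - by move=> x; exact: expR_ge0.
have -> : (\int[P]_(w in E `\` A) (step t w)%:E = P (E `\` A))%E.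
  rewrite (eq_integral (cst 1%E)); first by rewrite integral_cst// mul1e.
  move=> w; rewrite inE => -[Ew nA]; rewrite /step; case: ifP => // /andP[/eqP Iw wk].
  by exfalso; apply: nA.
by rewrite [in RHS]EA measureU//; exact/disj_set2P.
Qed.

(* Reweighting P by the next step leaves it unchanged on the past. *)
Lemma integral_wealth n : (n <= T)%N -> (\int[P]_w (wealth n w)%:E = 1)%E.
Proof.
elim: n => [|n IH] nT.
  under eq_integral do rewrite wealth0.
  by rewrite integral_cst// mul1e [LHS]probability_setT.
have tT : (1 <= n.+1 <= T)%N by [].
have tT1 : (n.+1 <= T.+1)%N by rewrite leqW.
have mst : measurable_fun setT (step n.+1).
  by apply: (@past_measurable_fun T.+1) => //; apply: step_measurable.
have st1 : (\int[P]_w (step n.+1 w)%:E = 1)%E.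
  by rewrite (integral_step tT (@past_setT _ _ _ _ I r n.+1)) [LHS]probability_setT.
have [mu muE] := probability_of_density mst (step_ge0 n.+1) st1.
have mw : measurable_fun setT (wealth n : pastT n.+1 -> R) by exact: wealth_measurable.
have mw' : measurable_fun setT (wealth n) by exact: (past_measurable_fun tT1).
have mphi : measurable_fun setT ((fun w => w) : Omega -> pastT n.+1).
  by move=> _ B mB; rewrite setTI; exact: (past_measurable run tT1).
transitivity (\int[P]_w ((wealth n w)%:E * (step n.+1 w)%:E))%E.
  by apply: eq_integral => w _; rewrite wealthS EFinM.
rewrite -(ge0_integral_density mst (step_ge0 n.+1) muE); last 2 first.
- exact/measurable_EFinP.
- by move=> w; rewrite lee_fin wealth_ge0.
(* [wealth n] is measurable for the past of round n + 1, so its integral sees a measure only through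
   the past events. *)
have push (Q : probability Omega R) : (\int[Q]_w (wealth n w)%:E =
    \int[pushforward Q ((fun w => w) : Omega -> pastT n.+1)]_w (wealth n w)%:E)%E.
  rewrite ge0_integral_pushforward//; first exact/measurable_EFinP.
  by move=> w _; rewrite lee_fin wealth_ge0.
rewrite push -(IH (ltnW nT)) push; apply: eq_measure_integral => B mB _.
rewrite -[LHS]/(mu B) -[RHS]/(P B) muE; last exact: (past_measurable run tT1).
exact: integral_step.
Qed.

Lemma wealthE n w : (pulls I n a w <= k)%N ->
  wealth n w = expR (lam * (\sum_(1 <= i < n.+1 | I i w == a) r i w) - psi * (pulls I n a w)%:R).
Proof.
elim: n => [|n IH].
  by rewrite wealth0 pulls0 big_nil !mulr0 subrr expR0.
rewrite wealthS pullsS => wk.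
rewrite IH; last by rewrite (leq_trans _ wk)// leq_addr.
have -> : \sum_(1 <= i < n.+2 | I i w == a) r i w =
    \sum_(1 <= i < n.+1 | I i w == a) r i w + (if I n.+1 w == a then r n.+1 w else 0).
  by rewrite big_mkcond big_nat_recr//= [in RHS]big_mkcond.
rewrite /step /=.
case: eqP wk => _ /=; last by rewrite mulr1 addn0 addr0.
rewrite addn1 => ->; rewrite -expRD -natr1; congr expR; ring.
Qed.

Lemma wealth_emp_mean n w : (0 < k)%N -> pulls I n a w = k ->
  wealth n w = expR (k%:R * (lam * emp_mean I r n a w - psi)).
Proof.
move=> k0 nk; rewrite wealthE ?nk// /emp_mean nk; congr expR; field.
by rewrite pnatr_eq0 -lt0n.
Qed.

Section tail.
Variables (B : set (measurableTypeR R)) (s : R).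
Hypotheses (k_gt0 : (0 < k)%N) (mB : measurable B).
Hypothesis Bs : forall z, B z -> s <= lam * z - psi.

Definition tail_event n := [set w | pulls I n a w = k] `&` [set w | B (emp_mean I r n a w)].

Lemma past_tail_event t n : (n < t)%N -> past I r t (tail_event n).
Proof. by move=> nt; apply: pastI; [exact: past_pulls_eq|exact: past_emp_mean_in]. Qed.

Lemma wealth_tail n w : tail_event n w -> expR (k%:R * s) <= wealth n w.
Proof.
move=> [/= nk /Bs bz]; rewrite wealth_emp_mean// ler_expR ler_wpM2l//.
Qed.

Lemma tail_bound n : (n <= T)%N -> pr (tail_event n) <= expR (- (k%:R * s)).
Proof.
move=> nT; rewrite expRN -[leRHS]mul1r ler_pdivlMr ?expR_gt0// mulrC.
have mt : measurable (tail_event n).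
  by apply: (past_measurable run (t := n.+1)) => //; exact: past_tail_event.
have := @sum_pr_le _ _ _ P _ tail_event [:: n] (wealth n) (expR (k%:R * s)) 1.
rewrite big_seq1; apply.
- by move=> t; rewrite inE => /eqP ->.
- exact: expR_ge0.
- by apply: (@past_measurable_fun n.+1) => //; exact: wealth_measurable.
- move=> w; rewrite big_seq1 indicE; case: (boolP (w \in _)) => [|_].
    by rewrite inE mulr1; exact: wealth_tail.
  by rewrite mulr0 wealth_ge0.
- by rewrite integral_wealth.
Qed.

(** Summing over all rounds costs nothing: the (k+1)-th pull of [a] happens in at most one round,
    and the wealth is frozen from the k-th pull on, so its final value dominates the whole count. *)
Lemma tail_sum_bound :
  \sum_(1 <= t < T.+1) pr (tail_event t.-1 `&` [set w | I t w = a]) <= expR (- (k%:R * s)).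
Proof.
rewrite expRN -[leRHS]mul1r ler_pdivlMr ?expR_gt0// mulrC.
apply: (@sum_pr_le _ _ _ P _ (fun t => tail_event t.-1 `&` [set w | I t w = a]) _ (wealth T)).
- move=> t; rewrite mem_index_iota => /andP[t1 tT]; apply: measurableI.
    apply: (past_measurable run (t := t)); first exact: ltnW.
    by apply: past_tail_event; rewrite prednK.
  by apply: run_I_measurable; rewrite t1.
- exact: expR_ge0.
- by apply: (@past_measurable_fun T.+1) => //; exact: wealth_measurable.
(* The factor [k < pulls] records that the count is still 0 before the (k+1)-th pull; at that pull
   it becomes 1, and no later round contributes. *)
- move=> w; have {}gen n : expR (k%:R * s) *
      \sum_(1 <= t < n.+1) \1_(tail_event t.-1 `&` [set w | I t w = a]) w <=
      (k < pulls I n a w)%N%:R * wealth n w.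
    elim: n => [|n IH]; first by rewrite big_nil mulr0 pulls0 mul0r.
    rewrite big_nat_recr//= mulrDr pullsS wealthS indicE.
    case: (boolP (w \in _)) => [|_].
      rewrite inE => -[wt /= Iw]; have nk : pulls I n a w = k by case: wt.
      move: IH; rewrite nk ltnn mul0r => IH.
      rewrite Iw eqxx addn1 ltnSn mul1r mulr1 /step /= nk ltnn andbF mulr1.
      by rewrite (le_trans _ (wealth_tail wt))// -[leRHS]add0r lerD.
    rewrite mulr0 addr0 (le_trans IH)//.
    case: (ltnP k (pulls I n a w)) => kn.
      by rewrite ltn_addr// /step /= ltnNge (ltnW kn) andbF mulr1.
    by rewrite mul0r mulr_ge0// mulr_ge0 ?step_ge0 ?wealth_ge0.
  rewrite (le_trans (gen T))// ler_piMl ?wealth_ge0// lern1 leq_b1//.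
- by rewrite integral_wealth.
Qed.

End tail.
End tilted_wealth.

(** * Sampling probabilities and expected pulls *)

Lemma arm_max_attained (R : realType) (K : nat) (a : 'I_K) (x : 'I_K -> R) :
  exists2 c, arm_max x = x c & forall b, x b <= arm_max x.
Proof.
pose c := [arg max_(i > a) x i]%O.
have cP b : x b <= x c by rewrite /c; case: arg_maxP => // i _; apply.
have e : arm_max x = x c.
  apply/eqP; rewrite eq_le; apply/andP; split.
    by apply: ge_sup; [exists (x a), a|move=> _ [b _ <-]].
  by apply: ub_le_sup; [exists (x c) => _ [b _ <-]|exists c].
by exists c => // b; rewrite e.
Qed.

(** The full series is 1 / (e^D - 1) <= 1 / D. The induction carries the sharper bound 1 - e^(-n D)
    on D times the sum. *)
Lemma sum_expR_geometric (R : realType) (D : R) (n : nat) : 0 < D ->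
  \sum_(1 <= k < n.+1) expR (- (k%:R * D)) <= D^-1.
Proof.
move=> D0; rewrite -[leRHS]mul1r ler_pdivlMr//.
have De : D * expR (- D) <= 1 - expR (- D).
  have : D * expR (- D) <= (expR D - 1) * expR (- D).
    by rewrite ler_wpM2r ?expR_ge0//; have := expR_ge1Dx D; lra.
  by rewrite mulrBl mul1r -expRD subrr expR0.
suff : (\sum_(1 <= k < n.+1) expR (- (k%:R * D))) * D <= 1 - expR (- (n%:R * D)).
  by have := expR_ge0 (- (n%:R * D)); lra.
elim: n => [|n IH]; first by rewrite big_nil !mul0r oppr0 expR0 subrr.
rewrite big_nat_recr//= mulrDl.
have -> : expR (- (n.+1%:R * D)) = expR (- (n%:R * D)) * expR (- D).
  by rewrite -expRD -natr1; congr expR; ring.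
have := ler_wpM2l (expR_ge0 (- (n%:R * D))) De; rewrite mulrBr mulr1.
move: IH; set q := expR _; set s := expR _; set A := \sum_(_ <= _ < _) _ => *.
by nra.
Qed.

Section arm_bound.
Context {R : realType} (K T : nat) (nu : 'I_K -> probability (measurableTypeR R) R).
Context {d : measure_display} {Omega : measurableType d}.
Variables (P : probability Omega R).
Variables (I : nat -> Omega -> 'I_K) (r : nat -> Omega -> R).
Variables (S : set R) (kl : R -> R -> R).
Local Notation p := (exp_kl_ms I r (fun k => k%:R) kl).
Hypothesis run : bandit_run nu T P I r p.
Hypothesis emp : emp_means_in T P I r S.
Hypothesis kl_ge0 : forall x y, S x -> S y -> 0 <= kl x y.
Hypothesis kl_pythagoras : forall x y z, S x -> S y -> S z -> x <= y -> y <= z ->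
  kl x y + kl y z <= kl x z.
Local Notation pr E := (fine (P E)).

(** Pythagoras at three equal points reads 2 kl x x <= kl x x. *)
Lemma kl_xx x : S x -> kl x x = 0.
Proof.
move=> Sx; apply/eqP; rewrite eq_le kl_ge0// andbT.
by rewrite -(lerD2l (kl x x)) addr0 kl_pythagoras.
Qed.

Lemma kl_le_l x y z : S x -> S y -> S z -> x <= y -> y <= z -> kl y z <= kl x z.
Proof.
move=> Sx Sy Sz xy yz; apply: le_trans (kl_pythagoras Sx Sy Sz xy yz).
by rewrite lerDr kl_ge0.
Qed.

Lemma kl_le_r x y z : S x -> S y -> S z -> x <= y -> y <= z -> kl x y <= kl x z.
Proof.
move=> Sx Sy Sz xy yz; apply: le_trans (kl_pythagoras Sx Sy Sz xy yz).
by rewrite lerDl kl_ge0.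
Qed.

Lemma pr_pull t a E : (1 <= t <= T)%N -> past I r t E ->
  P (E `&` [set w | I t w = a]) = (\int[P]_(w in E) (p t a w)%:E)%E.
Proof. by move=> tT; have [_ _ + _] := run tT; apply. Qed.

Lemma pr_init t a : (1 <= t <= T)%N -> (t <= K)%N ->
  P [set w | I t w = a] = ((a.+1 == t)%:R)%:E.
Proof.
move=> tT tK; rewrite -[X in P X]setTI pr_pull//; last exact: past_setT.
rewrite (eq_integral (cst ((a.+1 == t)%:R)%:E)); last first.
  by move=> w _; rewrite /exp_kl_ms tK.
by rewrite integral_cst// [X in (_ * X)%E]probability_setT mule1.
Qed.

Definition well_explored w := forall t c, (K < t <= T)%N ->
  (0 < pulls I t.-1 c w)%N /\ S (emp_mean I r t.-1 c w).

(** Arm c, counted from 0, is pulled in round c + 1 with probability 1, so every count is positive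
    after round K and [emp] applies. *)
Lemma ae_well_explored : {ae P, forall w, well_explored w}.
Proof.
have init : {ae P, forall w, forall c : 'I_K, (c.+1 <= T)%N -> I c.+1 w = c}.
  have h (c : 'I_K) : {ae P, forall w, (c.+1 <= T)%N -> I c.+1 w = c}.
    have [cT|cT] := leqP c.+1 T; last by apply: aeW => w.
    have tT : (1 <= c.+1 <= T)%N by [].
    have mI := run_I_measurable run c tT.
    exists (~` [set w | I c.+1 w = c]); split => //.
    - exact: measurableC.
    - by rewrite probability_setC// pr_init// eqxx subee.
    - by move=> w /= nI Iw; apply: nI.
  exact: (@filter_forall _ _ (fun (c : 'I_K) w => (c.+1 <= T)%N -> I c.+1 w = c) _ _ h).
apply: filterS2 init emp => w wI wS t c /andP[Kt tT].
have t1 : (1 <= t)%N by rewrite (leq_ltn_trans _ Kt).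
have ct : (c.+1 <= t.-1)%N by rewrite -ltnS prednK// (leq_ltn_trans (ltn_ord c)).
have ppos : (0 < pulls I t.-1 c w)%N.
  apply: leq_trans (pulls_homo _ _ _ ct).
  by rewrite pullsS wI ?eqxx ?addn1// (leq_trans ct)// (leq_trans (leq_pred _)).
split => //; apply: wS => //.
by rewrite (leq_trans _ ct)//= (leq_trans (leq_pred _)).
Qed.

Section weights.
Variables (t : nat) (w : Omega).
Hypotheses (tKT : (K < t <= T)%N) (gw : well_explored w).
Local Notation x := (fun c => emp_mean I r t.-1 c w).
Local Notation W := (fun c => kl_weight I r (fun k => k%:R) kl t c w).

Lemma emp_mean_S c : S (x c).
Proof. by have [] := gw c tKT. Qed.

Lemma emp_max_S (a : 'I_K) : S (arm_max x).
Proof. by have [c -> _] := arm_max_attained a x; exact: emp_mean_S. Qed.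

Lemma weight_le1 c : W c <= 1.
Proof.
rewrite /kl_weight -[leRHS]expR0 ler_expR mulNr oppr_le0 mulr_ge0//.
by rewrite kl_ge0//; [exact: emp_mean_S|exact: emp_max_S].
Qed.

(** The empirically best arm has weight 1, its divergence to the maximum being zero. *)
Lemma weight_sum_ge1 (a : 'I_K) : 1 <= \sum_(c < K) W c.
Proof.
have [c e _] := arm_max_attained a x.
rewrite (bigD1 c)//= {1}/kl_weight e kl_xx; last exact: emp_mean_S.
by rewrite mulr0 expR0 lerDl sumr_ge0// => b _; exact: expR_ge0.
Qed.

Lemma exp_kl_msE a : p t a w = W a / \sum_(c < K) W c.
Proof. by rewrite /exp_kl_ms leqNgt; case/andP: tKT => ->. Qed.

Lemma exp_kl_ms_le_weight a : p t a w <= W a.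
Proof.
have s1 := weight_sum_ge1 a.
rewrite exp_kl_msE ler_pdivrMr ?(lt_le_trans _ s1)// ler_peMr//.
exact: expR_ge0.
Qed.

(** All weights are at most 1 and share one normalization, so a pull of [a] can be charged to a pull
    of [o] at the price of the inverse weight of [o]. *)
Lemma exp_kl_ms_le_ratio a o : p t a w <= (W o)^-1 * p t o w.
Proof.
have s1 := weight_sum_ge1 a.
rewrite !exp_kl_msE mulrA mulVf ?expR_eq0//.
by rewrite ler_wpM2r ?weight_le1// invr_ge0 (le_trans _ s1).
Qed.

End weights.

Lemma exp_kl_ms_ge0 t a w : 0 <= p t a w.
Proof.
rewrite /exp_kl_ms; case: ifP => // _; rewrite divr_ge0// ?expR_ge0//.
by apply: sumr_ge0 => c _; exact: expR_ge0.
Qed.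

Lemma pr_pull_le t a E c : (1 <= t <= T)%N -> past I r t E -> 0 < c ->
  (forall w, well_explored w -> E w -> p t a w <= c) ->
  pr (E `&` [set w | I t w = a]) <= c.
Proof.
move=> tT pE c0 pc.
have mE : measurable E.
  by apply: (past_measurable run _ pE); case/andP: tT => _ tT; rewrite leqW.
have mI := run_I_measurable run a tT.
rewrite -lee_fin -prE; last exact: measurableI.
rewrite pr_pull//.
apply: (@le_trans _ _ (c%:E * \int[P]_(w in E) 1)%E).
  apply: ae_le_lower_integral => //.
    by move=> w _; rewrite lee_fin exp_kl_ms_ge0.
  by apply: filterS ae_well_explored => w gw Ew; rewrite mule1 lee_fin pc.
rewrite integral_cst// mul1e -[leRHS]mule1; apply: lee_wpmul2l.
  by rewrite lee_fin ltW.
exact: probability_le1.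
Qed.

Lemma pr_pull_le_ratio t a o E c : (1 <= t <= T)%N -> past I r t E -> 0 < c ->
  (forall w, well_explored w -> E w -> p t a w <= c * p t o w) ->
  pr (E `&` [set w | I t w = a]) <= c * pr (E `&` [set w | I t w = o]).
Proof.
move=> tT pE c0 pc.
have mE : measurable E.
  by apply: (past_measurable run _ pE); case/andP: tT => _ tT; rewrite leqW.
have mEI b : measurable (E `&` [set w | I t w = b]).
  by apply: measurableI => //; exact: (run_I_measurable run b tT).
rewrite -lee_fin EFinM -(prE P (mEI a)) -(prE P (mEI o)).
rewrite !pr_pull//; apply: ae_le_lower_integral => //.
- by move=> w _; rewrite lee_fin exp_kl_ms_ge0.
- by move=> w _; rewrite lee_fin exp_kl_ms_ge0.
- by apply: filterS ae_well_explored => w gw Ew; rewrite -EFinM lee_fin pc.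
Qed.

End arm_bound.

Lemma sum_cond_le (R : realType) (J : Type) (s : seq J) (Q : pred J) (f : J -> R) :
  (forall t, 0 <= f t) -> \sum_(t <- s | Q t) f t <= \sum_(t <- s) f t.
Proof.
by move=> f0; rewrite big_mkcond; apply: ler_sum => t _; case: ifP.
Qed.

Lemma sum_indicator_eq (R : realType) (b n : nat) :
  \sum_(1 <= t < n.+1) (b == t)%:R <= 1 :> R.
Proof.
suff : \sum_(1 <= t < n.+1) (b == t)%:R <= (b < n.+1)%N%:R :> R.
  by move=> /le_trans; apply; rewrite lern1 leq_b1.
elim: n => [|n IH]; first by rewrite big_nil.
rewrite big_nat_recr//= (le_trans (lerD IH (lexx _)))// -natrD ler_nat.
by case: (ltngtP b n.+1) => [h|h|->] /=; rewrite ?addn0 ?ltnSn //; rewrite (leqW h).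
Qed.

(** * Expected number of pulls of a suboptimal arm *)

Section arm_regret.
Context {R : realType} (K T : nat) (nu : 'I_K -> probability (measurableTypeR R) R).
Context {d : measure_display} {Omega : measurableType d}.
Variables (P : probability Omega R).
Variables (I : nat -> Omega -> 'I_K) (r : nat -> Omega -> R).
Variables (S : set R) (kl : R -> R -> R).
Local Notation p := (exp_kl_ms I r (fun k => k%:R) kl).
Hypothesis run : bandit_run nu T P I r p.
Hypothesis emp : emp_means_in T P I r S.
Hypothesis kl_ge0 : forall x y, S x -> S y -> 0 <= kl x y.
Hypothesis kl_gt0 : forall x y, S x -> S y -> x < y -> 0 < kl x y.
Hypothesis kl_pythagoras : forall x y z, S x -> S y -> S z -> x <= y -> y <= z ->
  kl x y + kl y z <= kl x z.
Hypothesis kl_cut : forall x y s, S x -> S y -> x <= y -> 0 <= s <= kl x y ->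
  exists z, [/\ S z, z <= y & kl z y = s].
Hypothesis kl_chernoff : forall c z, S z -> exists lam psi : R,
  [/\ (\int[nu c]_x (expR (lam * x - psi))%:E = 1)%E,
      z <= mean (nu c) -> forall x, x <= z -> kl z (mean (nu c)) <= lam * x - psi &
      mean (nu c) <= z -> forall x, z <= x -> kl z (mean (nu c)) <= lam * x - psi].
Local Notation pr E := (fine (P E)).
Variables (a o : 'I_K) (y' y D : R).
Hypotheses (So : S (mean (nu o))) (Sy' : S y') (Sy : S y).
Hypotheses (ay' : mean (nu a) <= y') (y'y : y' <= y) (yo : y <= mean (nu o)).
Hypotheses (D_gt0 : 0 < D) (Dy'y : D <= kl y' y) (Dy'a : D <= kl y' (mean (nu a)))
  (Dyo : D <= kl y (mean (nu o))).

Let kl_l := @kl_le_l _ S kl kl_ge0 kl_pythagoras.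
Let kl_r := @kl_le_r _ S kl kl_ge0 kl_pythagoras.

(* A stands for the half-line of the x <= y with kl x y >= s; by the Pythagorean
   inequality its endpoint z has kl z (mean (nu o)) >= s + D. *)
Definition cut_set (s : R) (A : set (measurableTypeR R)) : Prop :=
  [/\ measurable A,
      forall x, S x -> x <= y -> s <= kl x y -> A x,
      forall x, S x -> A x -> s <= kl x y &
      forall k n, (0 < k)%N -> (n <= T)%N ->
        pr (tail_event I r o k A n) <= expR (- (k%:R * (s + D))) /\
        \sum_(1 <= t < T.+1) pr (tail_event I r o k A t.-1 `&` [set w | I t w = o])
          <= expR (- (k%:R * (s + D)))].

(** If some z <= y has kl z y = s, the half-line up to z works: strict positivity of kl z x excludes
    points beyond z. The condition on s stands inside the existential so that [choice] yields a
    function of every real s. *)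
Lemma cut_set_exists s : exists A, 0 <= s -> cut_set s A.
Proof.
have [s0|s0] := leP 0 s; last by exists set0.
have [[z [Sz zy zs]]|nz] := pselect (exists z, [/\ S z, z <= y & kl z y = s]).
  exists `]-oo, z]%classic => _; split.
  - exact: measurable_itv.
  - move=> x Sx xy sx; rewrite /= in_itv /= leNgt; apply/negP => zx.
    have := kl_pythagoras Sz Sx Sy (ltW zx) xy; have := kl_gt0 Sz Sx zx.
    by rewrite zs; lra.
  - move=> x Sx; rewrite /= in_itv /= => xz; rewrite -zs.
    exact: kl_l.
  - move=> k n k0 nT; have [lam [psi [mgf lo _]]] := kl_chernoff o Sz.
    have Bs x : `]-oo, z]%classic x -> s + D <= lam * x - psi.
      rewrite /= in_itv /= => xz; apply: le_trans (lo (le_trans zy yo) _ xz).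
      apply: le_trans (kl_pythagoras Sz Sy So zy yo).
      by rewrite zs lerD2l.
    split; first exact: (tail_bound run mgf k0 (measurable_itv _) Bs nT).
    exact: (tail_sum_bound run mgf k0 (measurable_itv _) Bs).
(* Here [kl_cut] shows that no x <= y in S reaches level s. The Chernoff data at y merely
   instantiate the tail bounds for the empty event. *)
exists set0 => _; split => //.
- move=> x Sx xy sx; apply: nz; apply: (kl_cut Sx Sy xy).
  by rewrite s0.
- move=> k n k0 nT; have [lam [psi [mgf lo _]]] := kl_chernoff o Sy.
  have Bs x : (set0 : set (measurableTypeR R)) x -> s + D <= lam * x - psi by [].
  split; first exact: (tail_bound run mgf k0 measurable0 Bs nT).
  exact: (tail_sum_bound run mgf k0 measurable0 Bs).
Qed.

Lemma past_emp_max_lt t u : (0 < t)%N ->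
  past I r t [set w | arm_max (fun b => emp_mean I r t.-1 b w) < u].
Proof.
move=> t0; have -> : [set w | arm_max (fun b => emp_mean I r t.-1 b w) < u] =
    \bigcap_(c in [set: 'I_K]) [set w | emp_mean I r t.-1 c w < u].
  apply/seteqP; split => w /=.
    move=> h c _ /=; apply: le_lt_trans h.
    by have [_ _] := arm_max_attained a (fun b => emp_mean I r t.-1 b w).
  by move=> h; have [c -> _] := arm_max_attained a (fun b => emp_mean I r t.-1 b w); exact: h.
rewrite -measurable_pastE; apply: fin_bigcap_measurable => // c _.
rewrite measurable_pastE.
have := @past_emp_mean_in R K d Omega I r t t.-1 c `]-oo, u[%classic.
rewrite prednK// => /(_ (leqnn _) (measurable_itv _)); exact.
Qed.

Variables n n' : nat.
Hypotheses (T_gt0 : (0 < T)%N) (n_ge : ln T%:R <= n%:R * D) (n'_ge : 2 * ln T%:R <= n'%:R :> R).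

Section round.
Variable t : nat.
Hypothesis tKT : (K < t <= T)%N.
Let tT : (1 <= t <= T)%N.
Proof. by case/andP: tKT => Kt ->; rewrite andbT (leq_ltn_trans _ Kt). Qed.
Let t_gt0 : (0 < t)%N. Proof. by case/andP: tT. Qed.
Let tT1 : (t <= T.+1)%N. Proof. by case/andP: tT => _ h; rewrite leqW. Qed.
Let tp : (t.-1 < t)%N. Proof. by rewrite prednK. Qed.
Let tp1 : (t.-1 <= T)%N. Proof. by rewrite (leq_trans (leq_pred _))//; case/andP: tT. Qed.
Let mP E : past I r t E -> measurable E. Proof. exact: (past_measurable run tT1). Qed.
Local Notation hat c w := (emp_mean I r t.-1 c w).
Local Notation top w := (arm_max (fun b => emp_mean I r t.-1 b w)).
Local Notation pull c := [set w | I t w = c].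
Let mI c : measurable (pull c). Proof. exact: (run_I_measurable run c tT). Qed.

Definition converged := [set w | (n <= pulls I t.-1 a w)%N] `&`
  [set w | hat a w <= y'] `&` ~` [set w | top w < y].

Lemma past_converged : past I r t converged.
Proof.
apply: pastI; last by apply: pastC; exact: past_emp_max_lt.
apply: pastI.
  rewrite (_ : [set w | _] = ~` [set w | (pulls I t.-1 a w < n)%N]).
    by apply: pastC; exact: past_pulls_lt.
  by apply/seteqP; split => w /=; [rewrite ltnNge => ->|move/negP; rewrite -leqNgt].
have := @past_emp_mean_in R K d Omega I r t t.-1 a `]-oo, y']%classic.
move=> /(_ tp (measurable_itv _)); exact.
Qed.

Lemma pr_converged : pr (converged `&` pull a) <= T%:R^-1.
Proof.
apply: (@le_trans _ _ (expR (- (n%:R * D)))); last first.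
  by rewrite -[leRHS]lnK ?posrE ?invr_gt0 ?ltr0n// ler_expR lnV ?posrE ?ltr0n// lerN2.
apply: (pr_pull_le run emp tT past_converged (expR_gt0 _)).
move=> w gw [[/= nN ha] /negP]; rewrite -leNgt => hy.
have Sha := emp_mean_S tKT gw a; have Stop := emp_max_S tKT gw a.
apply: (le_trans (exp_kl_ms_le_weight kl_ge0 kl_pythagoras tKT gw a)).
rewrite /kl_weight ler_expR mulNr lerN2; apply: ler_pM => //.
- exact: ltW.
- by rewrite ler_nat.
(* Monotonicity in both arguments along hat a <= y' <= y <= top. *)
- apply: (le_trans Dy'y); apply: (@le_trans _ _ (kl (hat a w) y)).
    exact: kl_l.
  by apply: kl_r => //; exact: le_trans y'y.
Qed.

Lemma pr_overestimated :
  pr ([set w | y' <= hat a w] `&` pull a) <=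
  \sum_(1 <= k < T.+1) pr (tail_event I r a k `[y', +oo[%classic t.-1 `&` pull a).
Proof.
apply: pr_ae_le_sum.
- apply: measurableI => //; apply: mP.
  have := @past_emp_mean_in R K d Omega I r t t.-1 a `[y', +oo[%classic.
  move=> /(_ tp (measurable_itv _)); congr (past _ _ _ _).
  by apply/seteqP; split => w /=; rewrite in_itv /= andbT.
- move=> k _; apply: measurableI => //; apply: mP; apply: past_tail_event => //.
- apply: filterS (ae_well_explored run emp) => w gw [/= yh Iw].
  exists (pulls I t.-1 a w); last by split => //; split => //=; rewrite in_itv /= yh.
  by rewrite mem_index_iota (gw _ a tKT).1 ltnS (leq_trans (pulls_le _ _ _ _)).
Qed.

Variable A : R -> set (measurableTypeR R).
Hypothesis AP : forall s, 0 <= s -> cut_set s (A s).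

(* Peeling: the j-th layer consists of the outcomes where k * kl(hat o, y) lies
   in [j, j + 1) and every arm is estimated below y. *)
Definition layer (k j : nat) := tail_event I r o k (A (j%:R / k%:R) `\` A (j.+1%:R / k%:R)) t.-1 `&`
  [set w | top w < y].

Let frac_ge0 (j k : nat) : 0 <= j%:R / k%:R :> R. Proof. by rewrite divr_ge0. Qed.

Let mA j k : measurable (A (j%:R / k%:R)). Proof. by have [] := AP (frac_ge0 j k). Qed.

Lemma past_layer k j : past I r t (layer k j).
Proof.
apply: pastI; last exact: past_emp_max_lt.
by apply: past_tail_event => //; exact: measurableD.
Qed.

(** Since hat o <= top < y, the inverse weight exp(k kl(hat o, top)) of [o] is at most exp(k kl(hat
    o, y)) <= e^(j+1) on the layer. Charging to pulls of [o] is essential: for fixed k such a pull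
    occurs in one round only, so [tail_sum_bound] applies. *)
Lemma pr_layer k j : (0 < k)%N -> pr (layer k j `&` pull a) <=
  expR j.+1%:R * pr (tail_event I r o k (A (j%:R / k%:R)) t.-1 `&` pull o).
Proof.
move=> k0; apply: (@le_trans _ _ (expR j.+1%:R * pr (layer k j `&` pull o))).
  apply: (pr_pull_le_ratio run emp tT (past_layer k j) (expR_gt0 _)).
  move=> w gw [[/= ok [_ nAh]] hy].
  have Sho := emp_mean_S tKT gw o; have Stop := emp_max_S tKT gw a.
  have [_ _ tge] := arm_max_attained a (fun b => hat b w).
  have hoy : hat o w <= y by rewrite (le_trans (tge o))// ltW.
  apply: (le_trans (exp_kl_ms_le_ratio kl_ge0 kl_pythagoras tKT gw a o)).
  apply: ler_wpM2r; first exact: exp_kl_ms_ge0.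
  rewrite /kl_weight ok -expRN mulNr opprK ler_expR.
  have kk : 0 < k%:R :> R by rewrite ltr0n.
  apply: (@le_trans _ _ (k%:R * kl (hat o w) y)).
    by rewrite ler_pM2l// kl_r// ltW.
  rewrite mulrC -ler_pdivlMr// leNgt; apply/negP => lt.
  by apply: nAh; have [_ h _ _] := AP (frac_ge0 j.+1 k); apply: h => //; exact: ltW.
rewrite ler_pM2l ?expR_gt0//; apply: fine_le; rewrite ?fin_num_measure//.
- by apply: measurableI => //; apply: mP; exact: past_layer.
- by apply: measurableI => //; apply: mP; exact: past_tail_event.
- apply: le_measure; rewrite ?inE.
  + by apply: measurableI => //; apply: mP; exact: past_layer.
  + by apply: measurableI => //; apply: mP; exact: past_tail_event.
  + by move=> w [[[ok [Ah _]] _] Iw]; split.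
Qed.

(** No charging is done here: T^-2 is small enough to be summed over at most T rounds and T pull
    counts. *)
Lemma pr_last_layer k : (0 < k)%N -> (k <= T)%N ->
  pr (tail_event I r o k (A (n'%:R / k%:R)) t.-1) <= T%:R^-1 ^+ 2.
Proof.
move=> k0 kT; have [_ _ _ /(_ k t.-1 k0 tp1)[h _]] := AP (frac_ge0 n' k).
apply: (le_trans h).
have kk : 0 < k%:R :> R by rewrite ltr0n.
have T0 : 0 < T%:R :> R by rewrite ltr0n.
have -> : k%:R * (n'%:R / k%:R + D) = n'%:R + k%:R * D.
  by rewrite mulrDr mulrCA mulfV ?gt_eqF// mulr1.
have -> : T%:R^-1 ^+ 2 = expR (- (2 * ln T%:R)) :> R.
  by rewrite -mulrN expRM_natl expRN lnK ?posrE.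
by rewrite ler_expR lerN2 (le_trans n'_ge)// lerDl mulr_ge0// ltW.
Qed.

Lemma pr_underestimated :
  pr ([set w | top w < y] `&` pull a) <=
  \sum_(1 <= k < T.+1) (\sum_(0 <= j < n') pr (layer k j `&` pull a) +
     pr (tail_event I r o k (A (n'%:R / k%:R)) t.-1)).
Proof.
pose U := [set w | top w < y] `&` pull a.
have mU : measurable U.
  by apply: measurableI => //; apply: mP; exact: past_emp_max_lt.
have mk k : measurable (U `&` [set w | pulls I t.-1 o w = k]).
  by apply: measurableI => //; apply: mP; exact: past_pulls_eq.
apply: (@le_trans _ _ (\sum_(1 <= k < T.+1) pr (U `&` [set w | pulls I t.-1 o w = k]))).
  apply: pr_ae_le_sum => //.
  apply: filterS (ae_well_explored run emp) => w gw Uw.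
  exists (pulls I t.-1 o w) => //.
  by rewrite mem_index_iota (gw _ o tKT).1 ltnS (leq_trans (pulls_le _ _ _ _)).
rewrite big_seq [leRHS]big_seq; apply: ler_sum => k; rewrite mem_index_iota => /andP[k0 kT].
pose H j := if (j < n')%N then layer k j `&` pull a
  else tail_event I r o k (A (n'%:R / k%:R)) t.-1.
have -> : \sum_(0 <= j < n') pr (layer k j `&` pull a) +
     pr (tail_event I r o k (A (n'%:R / k%:R)) t.-1) = \sum_(0 <= j < n'.+1) pr (H j).
  rewrite big_nat_recr//= {2}/H ltnn; congr (_ + _).
  by rewrite big_nat [RHS]big_nat; apply: eq_bigr => j; rewrite /H => /andP[_ ->].
apply: pr_ae_le_sum => //.
  move=> j _; rewrite /H; case: ifP => _.
    by apply: measurableI => //; apply: mP; exact: past_layer.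
  by apply: mP; exact: past_tail_event.
apply: filterS (ae_well_explored run emp) => w gw [[/= hy Iw] ok].
have Sho := emp_mean_S tKT gw o.
have [_ _ tge] := arm_max_attained a (fun b => hat b w).
have hoy : hat o w <= y by rewrite (le_trans (tge o))// ltW.
have kk : 0 < k%:R :> R by rewrite ltr0n.
(* The layer index is the integer part of q, or the remainder event when q >= n'. *)
pose q := k%:R * kl (hat o w) y.
have q0 : 0 <= q by rewrite mulr_ge0// kl_ge0.
have inA j : j%:R <= q -> A (j%:R / k%:R) (hat o w).
  move=> jq; have [_ h _ _] := AP (frac_ge0 j k); apply: h => //.
  by rewrite ler_pdivrMr// mulrC.
have outA j : A (j%:R / k%:R) (hat o w) -> j%:R <= q.
  move=> Aj; have [_ _ h _] := AP (frac_ge0 j k).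
  by have := h _ Sho Aj; rewrite ler_pdivrMr// mulrC.
have [nq|qn] := leP n'%:R q.
  exists n'; first by rewrite mem_index_iota /=.
  by rewrite /H ltnn; split => //; exact: inA.
have /andP[j1 j2] := truncn_itv q0.
have jn : (Num.truncn q < n')%N by rewrite -(ltr_nat R) (le_lt_trans j1).
exists (Num.truncn q); first by rewrite mem_index_iota /= ltnW.
rewrite /H jn; split => //; split => //; split => //; split; first exact: inA.
by move=> /outA; rewrite leNgt j2.
Qed.

Lemma pr_round : pr (pull a) <=
  pr ([set w | (pulls I t.-1 a w < n)%N] `&` pull a) + T%:R^-1 +
  \sum_(1 <= k < T.+1) pr (tail_event I r a k `[y', +oo[%classic t.-1 `&` pull a) +
  \sum_(1 <= k < T.+1) (\sum_(0 <= j < n') expR j.+1%:R *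
     pr (tail_event I r o k (A (j%:R / k%:R)) t.-1 `&` pull o) + T%:R^-1 ^+ 2).
Proof.
pose E := [:: [set w | (pulls I t.-1 a w < n)%N] `&` pull a; converged `&` pull a;
  [set w | y' <= hat a w] `&` pull a; [set w | top w < y] `&` pull a].
have mE X : X \in E -> measurable X.
  rewrite !inE => /or4P[] /eqP ->; apply: measurableI => //; apply: mP.
  - exact: past_pulls_lt.
  - exact: past_converged.
  - have := @past_emp_mean_in R K d Omega I r t t.-1 a `[y', +oo[%classic.
    move=> /(_ tp (measurable_itv _)); congr (past _ _ _ _).
    by apply/seteqP; split => w /=; rewrite in_itv /= andbT.
  - exact: past_emp_max_lt.
have h : pr (pull a) <= \sum_(X <- E) pr X.
  apply: (pr_ae_le_sum (E := id)) => //; apply: aeW => w Iw.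
  have [nN|Nn] := leqP n (pulls I t.-1 a w); last first.
    by exists (nth set0 E 0); [rewrite mem_nth|].
  have [hy|hy] := leP (hat a w) y'; last first.
    by exists (nth set0 E 2); [rewrite mem_nth|split => //=; exact: ltW].
  have [ty|ty] := ltP (top w) y.
    by exists (nth set0 E 3); [rewrite mem_nth|].
  exists (nth set0 E 1); [by rewrite mem_nth|split => //; split => //].
  by apply/negP; rewrite -leNgt.
apply: (le_trans h); rewrite !big_cons big_nil addr0 !addrA.
apply: lerD; first apply: lerD; first apply: lerD; first by [].
- exact: pr_converged.
- exact: pr_overestimated.
apply: (le_trans pr_underestimated).
rewrite big_seq [leRHS]big_seq; apply: ler_sum => k; rewrite mem_index_iota => /andP[k0 kT].
apply: lerD; last exact: pr_last_layer.
by apply: ler_sum => j _; exact: pr_layer.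
Qed.

End round.
Lemma pr_initial_rounds : \sum_(1 <= t < T.+1 | (t <= K)%N) pr [set w | I t w = a] <= 1.
Proof.
apply: le_trans (sum_indicator_eq R a.+1 T).
rewrite big_seq_cond; apply: (@le_trans _ _ (\sum_(t <- index_iota 1 T.+1 |
  (t \in index_iota 1 T.+1) && (t <= K)%N) (a.+1 == t)%:R)).
  apply: ler_sum => t /andP[]; rewrite mem_index_iota ltnS => tT tK.
  by rewrite (pr_init run a tT tK).
by apply: sum_cond_le => t.
Qed.

(** The 3 collects at most one initial pull, T rounds at 1 / T, and T^2 terms at T^-2. Early pulls
    give n, overestimation of [a] gives 1 / D, and each of the n' layers gives e / D. *)
Lemma expected_pulls_le :
  \sum_(1 <= t < T.+1) pr [set w | I t w = a] <=
  n%:R + 3 + D^-1 + n'%:R * expR 1 / D.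
Proof.
have T0 : T%:R != 0 :> R by rewrite pnatr_eq0 -lt0n.
have [A AP] := choice cut_set_exists.
pose X t := pr ([set w | (pulls I t.-1 a w < n)%N] `&` [set w | I t w = a]).
pose Y k t := pr (tail_event I r a k `[y', +oo[%classic t.-1 `&` [set w | I t w = a]).
pose Z k j t := pr (tail_event I r o k (A (j%:R / k%:R)) t.-1 `&` [set w | I t w = o]).
pose F t := X t + T%:R^-1 + \sum_(1 <= k < T.+1) Y k t +
  \sum_(1 <= k < T.+1) (\sum_(0 <= j < n') expR j.+1%:R * Z k j t + T%:R^-1 ^+ 2).
have F0 t : 0 <= F t.
  rewrite /F !addr_ge0 ?pr_ge0 ?invr_ge0//; apply: sumr_ge0 => k _.
    exact: pr_ge0.
  rewrite addr_ge0 ?sqr_ge0//; apply: sumr_ge0 => j _.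
  by rewrite mulr_ge0 ?expR_ge0 ?pr_ge0.
have late : \sum_(1 <= t < T.+1 | ~~ (t <= K)%N) pr [set w | I t w = a] <=
    \sum_(1 <= t < T.+1) F t.
  apply: le_trans (sum_cond_le _ (fun t => ~~ (t <= K)%N) F0).
  rewrite big_seq_cond [leRHS]big_seq_cond; apply: ler_sum => t /andP[].
  rewrite mem_index_iota ltnS -ltnNge => /andP[_ tT] Kt.
  by apply: pr_round => //; rewrite Kt.
have sumX : \sum_(1 <= t < T.+1) X t <= n%:R by exact: (sum_pr_pulled run).
have sumC (c : R) : \sum_(1 <= t < T.+1) c = T%:R * c.
  by rewrite sumr_const_nat subn1 /= -[LHS]mulr_natl.
have sumT : \sum_(1 <= t < T.+1) T%:R^-1 = 1 :> R by rewrite sumC mulfV.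
have sumY : \sum_(1 <= t < T.+1) \sum_(1 <= k < T.+1) Y k t <= D^-1.
  rewrite exchange_big /=; apply: le_trans (sum_expR_geometric T D_gt0).
  rewrite big_seq [leRHS]big_seq; apply: ler_sum => k; rewrite mem_index_iota => /andP[k0 _].
  have [lam [psi [mgf _ hi]]] := kl_chernoff a Sy'.
  have Bs x : `[y', +oo[%classic x -> D <= lam * x - psi.
    by rewrite /= in_itv /= andbT => y'x; exact: (le_trans Dy'a (hi ay' _ y'x)).
  exact: (tail_sum_bound run mgf k0 (measurable_itv _) Bs).
have sumZ : \sum_(1 <= t < T.+1) \sum_(1 <= k < T.+1) \sum_(0 <= j < n') expR j.+1%:R * Z k j t
    <= n'%:R * expR 1 / D.
  rewrite exchange_big /=.
  apply: (@le_trans _ _ (\sum_(1 <= k < T.+1) n'%:R * expR 1 * expR (- (k%:R * D)))); last first.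
    by rewrite -mulr_sumr ler_wpM2l ?mulr_ge0 ?expR_ge0// sum_expR_geometric.
  rewrite big_seq [leRHS]big_seq; apply: ler_sum => k; rewrite mem_index_iota => /andP[k0 _].
  rewrite exchange_big /=.
  have kk : k%:R != 0 :> R by rewrite pnatr_eq0 -lt0n.
  apply: (@le_trans _ _ (\sum_(0 <= j < n') expR 1 * expR (- (k%:R * D)))); last first.
    by rewrite sumr_const_nat subn0 -[leLHS]mulr_natl mulrA.
  apply: ler_sum => j _; rewrite -mulr_sumr.
  have jk0 : 0 <= j%:R / k%:R :> R by rewrite divr_ge0.
  (* Time 0 is a placeholder, as only the bound on the sum over all rounds is kept. *)
  have [_ _ _ /(_ k 0%N k0 (leq0n _))[_ h]] := AP _ jk0.
  apply: (le_trans (ler_wpM2l (expR_ge0 _) h)).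
  (* As k (j / k + D) = j + k D, the price e^(j+1) leaves e times exp(- k D), independent of j. *)
  rewrite -!expRD ler_expR mulrDr mulrCA mulfV// mulr1 -natr1; lra.
have sumL : \sum_(1 <= t < T.+1) \sum_(1 <= k < T.+1) T%:R^-1 ^+ 2 = 1 :> R.
  by rewrite !sumC expr2 (mulrA T%:R T%:R^-1) mulfV// mul1r mulfV.
rewrite (bigID (fun t => (t <= K)%N)) /=.
apply: (le_trans (lerD pr_initial_rounds late)).
have -> : \sum_(1 <= t < T.+1) F t = \sum_(1 <= t < T.+1) X t + 1 +
    \sum_(1 <= t < T.+1) \sum_(1 <= k < T.+1) Y k t +
    (\sum_(1 <= t < T.+1) \sum_(1 <= k < T.+1) \sum_(0 <= j < n') expR j.+1%:R * Z k j t + 1).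
  rewrite -{3}sumL -{1}sumT -!big_split /=; apply: eq_bigr => t _.
  by rewrite /F -big_split.
move: sumX sumY sumZ.
move: (\sum_(1 <= t < T.+1) X t) (\sum_(1 <= t < T.+1) \sum_(1 <= k < T.+1) Y k t)
  (\sum_(1 <= t < T.+1) \sum_(1 <= k < T.+1) \sum_(0 <= j < n') expR j.+1%:R * Z k j t) => u v w.
by lra.
Qed.

End arm_regret.

(** * Regret *)

Section regret_decomposition.
Context {R : realType} (K T : nat) (nu : 'I_K -> probability (measurableTypeR R) R).
Context {d : measure_display} {Omega : measurableType d}.
Variables (P : probability Omega R) (I : nat -> Omega -> 'I_K).
Hypothesis mI : forall t a, (1 <= t <= T)%N -> measurable [set w | I t w = a].

Lemma gap_ge0 a : 0 <= gap nu a.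
Proof. by rewrite subr_ge0; have [_ _ h] := arm_max_attained a (mean \o nu); exact: h. Qed.

Lemma regretE : regret nu T P I =
  (\sum_(a < K) gap nu a * \sum_(1 <= t < T.+1) fine (P [set w | I t w = a]))%:E.
Proof.
rewrite /regret expectation.unlock.
have e w : \sum_(1 <= t < T.+1) gap nu (I t w) =
    \sum_(a < K) gap nu a * \sum_(1 <= t < T.+1) \1_[set w | I t w = a] w.
  under [RHS]eq_bigr do rewrite mulr_sumr.
  rewrite exchange_big /=; apply: eq_bigr => t _.
  rewrite (bigD1 (I t w))//= indicE mem_set// mulr1 big1 ?addr0// => a aI.
  by rewrite indicE memNset ?mulr0// => /= Iw; rewrite Iw eqxx in aI.
have mE a t : t \in index_iota 1 T.+1 -> measurable [set w | I t w = a].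
  by rewrite mem_index_iota ltnS; exact: mI.
under eq_integral do rewrite e -sumEFin.
rewrite ge0_integral_sum//; last 2 first.
- move=> a; apply/measurable_EFinP; apply: measurable_funM => //.
  by apply: measurable_sum_indic => t; exact: mE.
- by move=> a w _; rewrite lee_fin mulr_ge0 ?gap_ge0// sumr_ge0.
rewrite -sumEFin; apply: eq_bigr => a _.
under eq_integral do rewrite EFinM.
rewrite ge0_integralZl_EFin ?gap_ge0//; last 2 first.
- by move=> w _; rewrite lee_fin sumr_ge0.
- by apply/measurable_EFinP; apply: measurable_sum_indic => t; exact: mE.
by rewrite integral_sum_indic// => t; exact: mE.
Qed.

End regret_decomposition.

Section numeric_bound.
Context {R : realType}.

Lemma expR_half_le2 : expR (2^-1) <= 2 :> R.
Proof.
have := expR_ge1Dx (- 2^-1 : R); rewrite expRN => h.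
have e0 := expR_gt0 (2^-1 : R).
have : expR (2^-1) * (1 + - 2^-1) <= 1 :> R by rewrite -ler_pdivlMl// mulr1.
by lra.
Qed.

Lemma expR1_le4 : expR 1 <= 4 :> R.
Proof.
have h := expR_half_le2.
have -> : expR 1 = expR (2^-1) * expR (2^-1) :> R by rewrite -expRD; congr expR; lra.
by have := expR_ge0 (2^-1 : R); nra.
Qed.

Lemma ln_nat_ge_half (T : nat) : (2 <= T)%N -> 2^-1 <= ln T%:R :> R.
Proof.
move=> T2; have h := expR_half_le2.
rewrite -ler_expR lnK; first by apply: (le_trans h); rewrite ler_nat.
by rewrite posrE ltr0n (leq_trans _ T2).
Qed.

(** With e <= 4 one gets n' e + 1 <= 8 l + 5 <= 18 l, the last step by l >= 1/2; this is where T >=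
    2 enters. The bound on n adds l / D + 1. *)
Lemma pulls_budget_le (l D n n' : R) : 2^-1 <= l -> 0 < D -> n <= l / D + 1 ->
  n' <= 2 * l + 1 -> n + 3 + D^-1 + n' * expR 1 / D <= 4 + 19 * (l / D).
Proof.
move=> l2 D0 nl n'l; have e4 := expR1_le4; have e0 := expR_ge0 (1 : R).
have : n' * expR 1 + 1 <= 18 * l.
  have : n' * expR 1 <= (2 * l + 1) * expR 1 by rewrite ler_wpM2r.
  have : (2 * l + 1) * expR 1 <= (2 * l + 1) * 4 by rewrite ler_wpM2l//; lra.
  by lra.
rewrite -(ler_pM2r (_ : 0 < D^-1)) ?invr_gt0// mulrDl mul1r -mulrA => h.
by lra.
Qed.

(* 684 = 19 * 36, from D = g ^+ 2 / (36 * c) below. *)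
Definition regret_constant (c : R) : R := 4 + 684 * c.

Lemma regret_constant_gt0 c : 0 < c -> 0 < regret_constant c.
Proof. by rewrite /regret_constant => c0; lra. Qed.

Lemma regret_term_le (g l c D : R) : 0 < g -> 0 < c -> 0 <= l -> D = g ^+ 2 / (36 * c) ->
  g * (4 + 19 * (l / D)) <= regret_constant c * (l / g + g).
Proof.
rewrite /regret_constant => g0 c0 l0 ->.
have -> : l / (g ^+ 2 / (36 * c)) = 36 * c * (l / g) / g.
  by field; rewrite !gt_eqF.
have -> : g * (4 + 19 * (36 * c * (l / g) / g)) = 4 * g + 684 * c * (l / g).
  by field; rewrite gt_eqF.
have : 0 <= l / g by rewrite divr_ge0// ltW.
move: (l / g) => q q0.
by have := mulr_ge0 (ltW c0) (ltW g0); have := mulr_ge0 (ltW c0) q0; lra.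
Qed.

End numeric_bound.

Lemma equal_parameter_mean (R : realType) (m : {measure set (measurableTypeR R) -> \bar R})
    (theta : R) (nu nu' : probability (measurableTypeR R) R) :
  has_parameter m theta nu -> has_parameter m theta nu' -> mean nu = mean nu'.
Proof.
move=> nut nut'; rewrite /mean expectation.unlock; congr fine.
by apply: eq_measure_integral => A mA _; exact: (etrans (nut _ mA) (esym (nut' _ mA))).
Qed.

Theorem corollary13 (R : realType) (M CL : R) (V : R -> R) :
  0 < M -> 0 < CL ->
  (forall mu mu' : R, 0 < mu <= M -> 0 < mu' <= M ->
     `|V mu - V mu'| <= CL * `|mu - mu'|) ->
  exists C : R, 0 < C /\
  forall (m : {measure set (measurableTypeR R) -> \bar R}) (Theta : set R),
  is_exp_family m Theta ->
  smooth_log_partition m Theta ->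
  is_variance_function m Theta V ->
  forall (K T : nat), (2 <= K)%N -> (2 <= T)%N ->
  forall nu : 'I_K -> probability (measurableTypeR R) R,
  (forall a, exp_family_le m Theta M (nu a)) ->
  forall (d : measure_display) (Omega : measurableType d)
    (P : probability Omega R) (I : nat -> Omega -> 'I_K) (r : nat -> Omega -> R),
  bandit_run nu T P I r
    (exp_kl_ms I r (fun k => k%:R) (KL_mean m Theta)) ->
  emp_means_in T P I r (mean_space m Theta) ->
  (regret nu T P I <=
   (C * \sum_(a < K | 0 < gap nu a) (ln T%:R / gap nu a + gap nu a))%:E)%E.
Proof.
move=> M0 CL0 Vlip; pose c := `|V M| + CL * M.
have c0 : 0 < c by rewrite ltr_wpDl// mulr_gt0.
have Vle mu : 0 < mu <= M -> V mu <= c.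
  move=> /andP[mu0 muM]; have := Vlip mu M; rewrite mu0 muM M0 lexx => /(_ isT isT) h.
  have h1 : V mu - V M <= CL * `|mu - M| := le_trans (ler_norm _) h.
  have h2 : CL * `|mu - M| <= CL * M.
    by rewrite ler_pM2l// distrC ger0_norm ?subr_ge0// gerBl ltW.
  have h3 : V M <= `|V M| := ler_norm _.
  rewrite /c; lra.
exists (regret_constant c); split; first exact: regret_constant_gt0.
move=> m Theta family [b1 [b2 [bb1 b1b2 _ b2_gt0]]] Vvar K T K2 T2 nu nuF d Omega P I r run emp.
rewrite (regretE nu P (run_I_measurable run)) lee_fin.
rewrite (bigID (fun a => 0 < gap nu a)) /= [X in _ + X]big1 ?addr0; last first.
  move=> a; rewrite -leNgt => ga; suff -> : gap nu a = 0 by rewrite mul0r.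
  by apply/eqP; rewrite eq_le ga gap_ge0.
rewrite mulr_sumr; apply: ler_sum => a ga.
have [best bestE _] := arm_max_attained a (mean \o nu).
have gE : gap nu a = mean (nu best) - mean (nu a) by rewrite /gap bestE.
have [ [ta Tta nuta] /andP[a0 aM]] := nuF a.
have [ [tb Ttb nutb] /andP[best0 bestM]] := nuF best.
(* A positive gap forces two distinct parameters, so [Theta] is not a single point, where a
   derivative within [Theta] would carry no information. *)
have tao : ta != tb.
  apply/eqP => e; move: ga; rewrite gE; move: nutb; rewrite -e => nutb.
  by rewrite (equal_parameter_mean nuta nutb) subrr ltxx.
pose g := gap nu a.
have Sa := (exp_family_param family bb1 b1b2 b2_gt0 Tta Ttb tao (nuF a).1).1.
have So := (exp_family_param family bb1 b1b2 b2_gt0 Tta Ttb tao (nuF best).1).1.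
(* The points mu_a, y', y, mu_max are equally spaced by g / 3, so one quadratic estimate yields D
   for all three divergences. *)
pose y' := mean (nu a) + g / 3; pose y := mean (nu best) - g / 3.
have g0 : 0 < g by [].
have bestag : mean (nu best) = mean (nu a) + g by rewrite /g gE addrCA subrr addr0.
have yy' : y - y' = g / 3 by rewrite /y /y' bestag; field.
have y'y : y' <= y by rewrite -subr_ge0 yy' divr_ge0// ltW.
have ay' : mean (nu a) <= y' by rewrite lerDl divr_ge0// ltW.
have yo : y <= mean (nu best) by rewrite gerBl divr_ge0// ltW.
have btw := mean_space_between family bb1 b1b2 b2_gt0 Tta Ttb tao Sa So.
have Sy' : mean_space m Theta y' by apply: btw; rewrite ay' (le_trans y'y).
have Sy : mean_space m Theta y by apply: btw; rewrite yo (le_trans ay').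
have y'0 : 0 < y' <= M by rewrite (lt_le_trans a0)//= (le_trans y'y)// (le_trans yo).
have y0 : 0 < y <= M by rewrite (lt_le_trans a0) ?(le_trans ay')//= (le_trans yo).
pose D := g ^+ 2 / (36 * c).
have D0 : 0 < D by rewrite divr_gt0 ?exprn_gt0 ?mulr_gt0.
have quad x z : mean_space m Theta x -> mean_space m Theta z -> 0 < x <= M -> 0 < z <= M ->
    (x - z) ^+ 2 = (g / 3) ^+ 2 -> D <= KL_mean m Theta x z.
  move=> Sx Sz xM zM e.
  have := KL_mean_quadratic family bb1 b1b2 b2_gt0 Tta Ttb tao c0 Vle Vvar Sx Sz xM zM.
  by apply: le_trans; rewrite e /D le_eqVlt; apply/orP; left; apply/eqP; field; rewrite gt_eqF.
have nuM b : 0 < mean (nu b) <= M by have [] := nuF b.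
have lT := ln_nat_ge_half (R := R) T2.
have lT0 : 0 <= ln T%:R :> R by rewrite (le_trans _ lT)// invr_ge0.
have lD0 : 0 <= ln T%:R / D by rewrite divr_ge0// ltW.
have l20 : 0 <= 2 * ln T%:R :> R by rewrite mulr_ge0.
(* Successors of integer parts: at least the required thresholds, and at most 1 above them. *)
pose n := (Num.truncn (ln T%:R / D)).+1; pose n' := (Num.truncn (2 * ln T%:R : R)).+1.
have /andP[n1 n2] := truncn_itv lD0; have /andP[n'1 n'2] := truncn_itv l20.
have bound := expected_pulls_le run emp
  (KL_mean_ge0 family bb1 b1b2 b2_gt0 Tta Ttb tao)
  (KL_mean_gt0 family bb1 b1b2 b2_gt0 Tta Ttb tao).
have {}bound : \sum_(1 <= t < T.+1) fine (P [set w | I t w = a]) <=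
    n%:R + 3 + D^-1 + n'%:R * expR 1 / D.
  apply: (bound _ _ _ a best y' y D) => //.
  - move=> x u z Sx Su Sz xu uz.
    apply: (KL_mean_pythagoras family bb1 b1b2 b2_gt0 Tta Ttb tao) => //.
    by rewrite mulr_ge0// subr_ge0.
  - move=> x u s; exact: (KL_mean_cut family bb1 b1b2 b2_gt0 Tta Ttb tao).
  - move=> b z; exact: (KL_mean_chernoff family bb1 b1b2 b2_gt0 Tta Ttb tao (nuF b).1).
  - by apply: quad => //; rewrite -sqrrN opprB yy'.
  - by apply: quad => //; rewrite /y' addrAC subrr add0r.
  - by apply: quad => //; rewrite /y addrAC subrr add0r sqrrN.
  - by rewrite (leq_trans _ T2).
  - by rewrite -ler_pdivrMr// ltW.
  - exact: ltW.
apply: le_trans (regret_term_le g0 c0 lT0 (erefl D)).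
rewrite ler_pM2l//; apply: (le_trans bound).
apply: pulls_budget_le => //.
- by rewrite /n -natr1 lerD2r.
- by rewrite /n' -natr1 lerD2r.
Qed.
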